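(* Let $n\ge 1$, let $A \in \mathfrak{B}(2n)$, and let $M(A)$ be the associated real Bott manifold, equipped with a symplectic form $\omega$ given by $$\omega = \sum_{j<k,\ A_j = A_k} c_{j,k}\, du_j \wedge du_k, \qquad c_{j,k} \in \mathbb{R}.$$ Then the flux group $\Gamma_\omega$ of $(M(A),\omega)$ is a lattice of full rank in $H^1(M(A))$, i.e. a discrete subgroup of $H^1(M(A))$ that spans $H^1(M(A))$ over $\mathbb{R}$.
   Context: All cohomology $H^*$ is de Rham cohomology over $\mathbb{R}$. Real Bott manifolds. For a positive integer $m$, $\mathfrak{B}(m)$ denotes the set of $m \times m$ upper triangular matrices with entries in $\{0,1\}$ and zero diagonal entries. For $A \in \mathfrak{B}(m)$, $A^i_j$ denotes the $(i,j)$ entry and $A_j$ the $j$-th column of $A$. Let $S^1$ be the unit circle in $\mathbb{C}$ and $T^m = (S^1)^m$. For $z \in S^1$ and $a \in \mathbb{Z}/2=\{0,1\}$, put $z(a) := z$ if $a=0$ and $z(a) := \bar z$ if $a=1$. For $i=1,\dots,m$ define the involution $a_i$ on $T^m$ by $$a_i(z_1,\dots,z_m) := (z_1,\dots,z_{i-1}, -z_i, z_{i+1}(A^i_{i+1}), \dots, z_m(A^i_m)),$$ and let $G(A)$ be the finite transformation group generated by $a_1,\dots,a_m$; then $M(A) := T^m/G(A)$, a closed smooth manifold. Equivalently, let $\Gamma(A)$ be the group of affine transformations of $\mathbb{R}^m$ generated by $$s_i(u_1,\dots,u_m) := \left(u_1,\dots,u_{i-1}, u_i + \tfrac12, (-1)^{A^i_{i+1}}u_{i+1},\dots,(-1)^{A^i_m}u_m\right),\quad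 i=1,\dots,m;$$ the coordinatewise map $u \mapsto \exp(2\pi\sqrt{-1}\,u)$ induces a diffeomorphism $\mathbb{R}^m/\Gamma(A) \cong T^m/G(A) = M(A)$. Here $du_1,\dots,du_m$ are the standard $1$-forms on $\mathbb{R}^m$. If $A_j = A_k$, the $2$-form $du_j\wedge du_k$ is $\Gamma(A)$-invariant and so descends to $M(A)$; the formula for $\omega$ denotes the descended form on $M(A)$, and $\omega$ is assumed to be symplectic (nondegenerate). Flux group. Let $(M,\omega)$ be a closed symplectic manifold, $\mathrm{Symp}(M,\omega)$ the group of diffeomorphisms $\phi$ of $M$ with $\phi^*\omega = \omega$, and $\mathrm{Symp}_0(M,\omega)$ its identity component. For a symplectic isotopy $\{\phi_t\}_{0\le t\le 1}$ (a smooth path in $\mathrm{Symp}(M,\omega)$ with $\phi_0 = \mathrm{id}$), let $X_t$ be the time-dependent vector field with $\frac{d}{dt}\phi_t = X_t\circ\phi_t$. The flux of $\{\phi_t\}$ is $$\int_0^1 [i_{X_t}\omega]\,dt \in H^1(M).$$ It depends only on the homotopy class of the isotopy with fixed end points. The flux group $\Gamma_\omega \subset H^1(M)$ is the image of $\pi_1(\mathrm{Symp}_0(M,\omega))$ (based at $\mathrm{id}$) under the flux, i.e. the set of fluxes of symplectic isotopies with $\phi_0=\phi_1=\mathrm{id}$. *)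

(* Defs.v *)
From HB Require Import structures.
From mathcomp Require Import all_boot all_order all_algebra.
From mathcomp Require Import generic_quotient ring_quotient.
From mathcomp Require Import all_classical all_reals all_analysis.
Set Implicit Arguments.
Unset Strict Implicit.
Unset Printing Implicit Defensive.
Import Order.TTheory GRing.Theory Num.Theory.
Import numFieldNormedType.Exports.
Local Open Scope classical_set_scope.
Local Open Scope ring_scope.
Local Open Scope quotient_scope.

(* The quotient of a module by a submodule: the quotient group of
   [ring_quotient], with the induced scaling. *)
Section LmoduleQuotient.
Variables (R : pzRingType) (W : lmodType R).

Definition submod_pred (I : {pred W}) of submod_closed I : {pred W} := I.
HB.instance Definition _ I I_submod :=
  GRing.isSubmodClosed.Build R W (@submod_pred I I_submod) I_submod.

Variables (I : {pred W}) (I_submod : submod_closed I).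

Definition lquot := Quotient.quot (submod_pred I_submod).
HB.instance Definition _ := GRing.Zmodule.on lquot.

Definition lclass (w : W) : lquot := \pi_(Quotient.quot _) w.

Lemma lclassP (x : lquot) : exists w, x = lclass w.
Proof. by exists (repr x); rewrite /lclass reprK. Qed.

Lemma lclass_eq (v w : W) : lclass v = lclass w <-> v - w \in I.
Proof.
have := Quotient.idealrBE (submod_pred I_submod) v w.
by rewrite [v - w \in _]/(v - w \in I) => ->; split=> /eqP.
Qed.

Lemma lclassD v w : lclass (v + w) = lclass v + lclass w.
Proof. by rewrite /lclass raddfD. Qed.

Definition lquot_scale (a : R) (x : lquot) : lquot := lclass (a *: repr x).

Lemma lclassZ a w : lclass (a *: w) = lquot_scale a (lclass w).
Proof.
have [I0 IL] := I_submod.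
apply/lclass_eq; rewrite -scalerBr -[_ *: _]addr0; apply: IL => //.
by apply/lclass_eq; rewrite /lclass reprK.
Qed.

Fact lquot_scaleA a b x :
  lquot_scale a (lquot_scale b x) = lquot_scale (a * b) x.
Proof. by have [w ->] := lclassP x; rewrite -!lclassZ scalerA. Qed.
Fact lquot_scale1 : left_id 1 lquot_scale.
Proof. by move=> x; have [w ->] := lclassP x; rewrite -!lclassZ scale1r. Qed.
Fact lquot_scaleDr : right_distributive lquot_scale +%R.
Proof.
move=> a x y; have [v ->] := lclassP x; have [w ->] := lclassP y.
by rewrite -lclassD -!lclassZ -lclassD scalerDr.
Qed.
Fact lquot_scaleDl x : {morph lquot_scale^~ x : a b / a + b}.
Proof.
by move=> a b; have [w ->] := lclassP x; rewrite -!lclassZ -lclassD scalerDl.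
Qed.
HB.instance Definition _ := GRing.Zmodule_isLmodule.Build R lquot
  lquot_scaleA lquot_scale1 lquot_scaleDr lquot_scaleDl.
End LmoduleQuotient.

Section Smooth.
Variables (R : realType) (V W : normedModType R).

(* C^k on an open set [U] of a finite-dimensional space; the values of [f]
   outside [U] are irrelevant. *)
Fixpoint Ck_on (U : set V) (k : nat) (f : V -> W) : Prop :=
  if k is k'.+1 then
    (forall x, U x -> differentiable f x) /\
    (forall v, Ck_on U k' (fun x => 'D_v f x))
  else forall x, U x -> {for x, continuous f}.

Definition smooth_on (U : set V) (f : V -> W) := forall k, Ck_on U k f.

Lemma Ck_onP (k : nat) (a : R) (f g : V -> W) :
  Ck_on setT k f -> Ck_on setT k g -> Ck_on setT k (a *: f + g).
Proof.
elim: k f g => [|k IH] f g /=.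
  by move=> cf cg x _; apply: continuousD; [apply: continuousZr|];
    [exact: cf|exact: cg].
move=> [df Df] [dg Dg]; split=> [x _|v].
  by apply: differentiableD; [apply: differentiableZ; exact: df|exact: dg].
rewrite (_ : (fun x => _) =
  a *: (fun x => 'D_v f x) + (fun x => 'D_v g x)); first exact: IH.
apply/funext => x; have dfx : derivable f x v by apply/diff_derivable/df.
by rewrite deriveD ?deriveZ//; [exact: derivableZ|exact/diff_derivable/dg].
Qed.

Lemma Ck_on0 (k : nat) : Ck_on setT k (0 : V -> W).
Proof.
elim: k => [|k IH] /=; first by move=> x _; exact: cst_continuous.
split=> [x _|v]; first exact: differentiable_cst.
by rewrite (_ : (fun x => _) = 0)//; apply/funext => x; rewrite derive_cst.
Qed.

Lemma smooth_derivable (f : V -> W) u v : smooth_on setT f -> derivable f u v.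
Proof. by move=> sf; apply/diff_derivable; apply: (sf 1%N).1. Qed.

End Smooth.

Section RealBott.
Variables (R : realType) (m : nat).
Notation V := 'rV[R]_m.

Definition bott_matrix (A : 'M[bool]_m) :=
  forall i j : 'I_m, (j <= i)%N -> A i j = false.

Variable A : 'M[bool]_m.

Definition s_ (i : 'I_m) (u : V) : V :=
  \row_j (if (j < i)%N then u 0 j
          else if j == i then u 0 j + 2%:R^-1
          else (-1) ^+ (A i j) * u 0 j).

(* The transformation group of R^m generated by the s_ i. *)
Inductive Gamma : (V -> V) -> Prop :=
| Gamma_gen i : Gamma (s_ i)
| Gamma_id : Gamma id
| Gamma_comp g g' : Gamma g -> Gamma g' -> Gamma (g \o g')
| Gamma_inv g g' : Gamma g -> cancel g g' -> cancel g' g -> Gamma g'.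

Definition same_orbit (u v : V) : bool := `[< exists2 g, Gamma g & v = g u >].

Lemma s_bij i : exists2 g', cancel (s_ i) g' & cancel g' (s_ i).
Proof.
exists (fun u => \row_j (if (j < i)%N then u 0 j
          else if j == i then u 0 j - 2%:R^-1
          else (-1) ^+ (A i j) * u 0 j)) => u; apply/rowP => j; rewrite !mxE;
  case: (j < i)%N => //; case: (j == i); rewrite ?addrK ?subrK //;
  by rewrite mulrA -expr2 sqrr_sign mul1r.
Qed.

Lemma Gamma_bij g : Gamma g -> exists2 g', cancel g g' & cancel g' g.
Proof.
elim=> [i||f f' _ [h fh hf] _ [h' fh' hf']|f f' _ _ c c'].
- exact: s_bij.
- by exists id.
- by exists (h' \o h); exact: can_comp.
- by exists f.
Qed.

Lemma same_orbit_equiv : equiv_class_of same_orbit.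
Proof.
have sym u v : same_orbit u v -> same_orbit v u.
  move=> /asboolP[g Gg ->]; have [g' c c'] := Gamma_bij Gg.
  by apply/asboolP; exists g' => //; exact: Gamma_inv Gg c c'.
split=> [u|u v|v u w].
- by apply/asboolP; exists id => //; exact: Gamma_id.
- by apply/idP/idP; exact: sym.
- move=> /asboolP[g Gg ->] /asboolP[g' Gg' ->].
  by apply/asboolP; exists (g' \o g) => //; exact: Gamma_comp.
Qed.

Canonical same_orbit_equiv_rel := EquivRelPack same_orbit_equiv.

(* M(A) = R^m / Gamma(A).  Its charts are the local inverses of the
   projection [pr], with transition maps in Gamma(A).  Hence tensors on M(A)
   are Gamma(A)-invariant tensors on R^m, and a map into M(A) is smooth when it
   locally has smooth lifts through [pr]. *)
Definition bott_manifold := {eq_quot same_orbit}.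
Notation M := bott_manifold.

Definition pr (u : V) : M := \pi_({eq_quot same_orbit}) u.

(* A 1-form is given by its coefficients: [a] stands for
   sum_j (a u 0 j) du_j. *)
Definition pairing (a v : V) : R := \sum_j a 0 j * v 0 j.

Definition closed_form_pred : {pred V -> V} := fun a => `[<
  [/\ smooth_on setT a,
      (forall g, Gamma g -> forall u v,
         pairing (a (g u)) ('D_v g u) = pairing (a u) v) &
      (forall u j k, ('D_'e_j a u) 0 k = ('D_'e_k a u) 0 j)] >].

Lemma closed_form_submod : submod_closed closed_form_pred.
Proof.
split.
  apply/asboolP; split=> [k|g _ u v|u j k]; first exact: Ck_on0.
    by rewrite /pairing !big1// => j _; rewrite mxE mul0r.
  by rewrite !derive_cst !mxE.
move=> c a b /asboolP[sa ia ca] /asboolP[sb ib cb].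
apply/asboolP; split=> [k|g Gg u v|u j k].
- exact: Ck_onP.
- have pl x y w : pairing (c *: x + y) w = c * pairing x w + pairing y w.
    rewrite /pairing mulr_sumr -big_split/=; apply: eq_bigr => j _.
    by rewrite !mxE mulrDl mulrA.
  by rewrite [LHS]pl [RHS]pl ia// ib.
- have da v : derivable a u v := smooth_derivable sa.
  have db v : derivable b u v := smooth_derivable sb.
  have dca v : derivable (c *: a) u v by exact: derivableZ.
  by rewrite !deriveD// !deriveZ// !mxE ca cb.
Qed.

HB.instance Definition _ :=
  GRing.isSubmodClosed.Build R (V -> V) closed_form_pred closed_form_submod.

Record closed_form := ClosedForm
  { form_coef :> V -> V; _ : form_coef \in closed_form_pred }.
HB.instance Definition _ := [isSub for form_coef].
HB.instance Definition _ := [Choice of closed_form by <:].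
HB.instance Definition _ := [SubChoice_isSubLmodule of closed_form by <:].

Definition exact_form_pred : {pred closed_form} := fun a => `[<
  exists2 f : M -> R, smooth_on setT (fun u : V => f (pr u)) &
    forall u j, a u 0 j = 'D_'e_j (fun u : V => f (pr u)) u >].

Lemma exact_form_submod : submod_closed exact_form_pred.
Proof.
split.
  apply/asboolP; exists (fun=> 0) => [k|u j]; first exact: Ck_on0.
  by rewrite derive_cst mxE.
move=> c a b /asboolP[f sf af] /asboolP[g sg bg].
apply/asboolP; exists (fun x => c *: f x + g x) => [k|u j].
  exact: (Ck_onP c (sf k) (sg k)).
have df v : derivable (fun u : V => f (pr u)) u v := smooth_derivable sf.
have dg v : derivable (fun u : V => g (pr u)) u v := smooth_derivable sg.
transitivity (c *: a u 0 j + b u 0 j); first by rewrite !mxE.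
rewrite af bg -deriveZ// -deriveD//; exact: derivableZ.
Qed.

(* De Rham cohomology H^1(M(A)). *)
Definition H1 := lquot exact_form_submod.
HB.instance Definition _ := GRing.Lmodule.on H1.

Definition coh_class (a : closed_form) : H1 := lclass exact_form_submod a.

Definition vector_field (X : V -> V) :=
  smooth_on setT X /\ forall g, Gamma g -> forall u, X (g u) = 'D_(X u) g u.

(* A 2-form: [omega u v w] is its value at the point [u] on the tangent
   vectors [v] and [w]. *)
Implicit Type omega : V -> V -> V -> R.

Definition contraction omega (X : V -> V) : V -> V :=
  fun u => \row_j omega u (X u) 'e_j.

Definition nondegenerate_form omega :=
  forall u v, (forall w, omega u v w = 0) -> v = 0.

Definition local_lift (f : M -> M) (U : set V) (h : V -> V) :=
  [/\ open U, smooth_on U h & forall u, U u -> pr (h u) = f (pr u)].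

Definition smooth_map (f : M -> M) :=
  forall u, exists U h, U u /\ local_lift f U h.

Definition diffeomorphism (f : M -> M) :=
  smooth_map f /\ exists g, [/\ smooth_map g, cancel f g & cancel g f].

(* f^* omega = omega; the differential of f is read off any local lift. *)
Definition preserves omega (f : M -> M) :=
  forall U h, local_lift f U h ->
  forall u v w, U u -> omega (h u) ('D_v h u) ('D_w h u) = omega u v w.

Definition Symp omega : set (M -> M) :=
  [set f | diffeomorphism f /\ preserves omega f].

(* Smoothness on [0, 1] x M(A), at t = 0 and t = 1 included, means that local
   smooth extensions to open subsets of R x M(A) exist. *)
Definition isotopy_lift (phi : R -> M -> M) (U : set (R * V)) (h : R * V -> V) :=
  [/\ open U, smooth_on U h & forall t u, U (t, u) -> t \in `[0, 1] ->
        pr (h (t, u)) = phi t (pr u)].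

Definition symplectic_isotopy omega (phi : R -> M -> M) :=
  [/\ forall t, t \in `[0, 1] -> Symp omega (phi t),
      forall t u, t \in `[0, 1] ->
        exists U h, U (t, u) /\ isotopy_lift phi U h &
      phi 0 = id].

(* d/dt phi_t = X_t o phi_t, computed in local lifts. *)
Definition generated_by (phi : R -> M -> M) (X : R -> V -> V) :=
  (forall t, t \in `[0, 1] -> vector_field (X t)) /\
  forall U h, isotopy_lift phi U h ->
  forall t u, U (t, u) -> t \in `[0, 1] ->
    'D_((1, 0) : R * V) h (t, u) = X t (h (t, u)).

(* [x] is the integral over [0, 1] of the path [p] in the vector space [H]
   (which is used for the finite-dimensional H^1 only). *)
Definition is_integral01 (H : lmodType R) (p : R -> H) (x : H) :=
  forall l : {scalar H},
    lebesgue_measure.-integrable `[0, 1] (fun t => (l (p t))%:E) /\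
    \int[lebesgue_measure]_(t in `[0, 1]) l (p t) = l x.

Definition is_flux omega (phi : R -> M -> M) (x : H1) :=
  exists (X : R -> V -> V) (a : R -> closed_form),
    [/\ generated_by phi X,
        forall t, t \in `[0, 1] -> form_coef (a t) = contraction omega (X t) &
        is_integral01 (fun t => coh_class (a t)) x].

Definition flux_group omega : set H1 :=
  [set x | exists phi,
     [/\ symplectic_isotopy omega phi, phi 1 = id & is_flux omega phi x]].

(* sum_{j < k, A_j = A_k} c_{j,k} du_j /\ du_k *)
Definition bott_form (c : 'I_m -> 'I_m -> R) : V -> V -> V -> R :=
  fun _ v w => \sum_(j < m) \sum_(k < m | (j < k)%N && (col j A == col k A))
     c j k * (v 0 j * w 0 k - v 0 k * w 0 j).

End RealBott.

Arguments flux_group {R m} A omega.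
Arguments H1 {R m} A.

Section Lattice.
Variables (R : realType) (H : lmodType R).

(* The topology of a finite-dimensional real vector space is the one carried
   over from R^d by any linear isomorphism. *)
Definition discrete_in (G : set H) :=
  exists (d : nat) (L : {linear H -> 'rV[R]_d}),
    bijective L /\ forall y, (L @` G) y -> isolated (L @` G) y.

Definition subgroup (G : set H) :=
  G 0 /\ forall x y, G x -> G y -> G (x - y).

Definition spanning (G : set H) :=
  forall x, exists (d : nat) (a : 'I_d -> R) (g : 'I_d -> H),
    (forall i, G (g i)) /\ x = \sum_i a i *: g i.

Definition full_rank_lattice (G : set H) :=
  [/\ subgroup G, discrete_in G & spanning G].

End Lattice.

(* Main.v *)
(* Let J be the set of the j with A_j = 0.  H^1(M(A)) has the classes of the
   du_j, j in J, as a basis, and the coordinates of a class are the periods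
   P('e_j) of a primitive P on R^m of a representing closed form.

   The flux group is {[i_b omega] : b in L}, where L is the group of the b in R^J
   whose translation lies in Gamma(A).  The translation loops t |-> u + t b give
   one inclusion.  Conversely lift the orbit square (t, s) |-> phi_t(s e_j) of a
   symplectic loop to R^m.  Uniqueness of lifts shows that the lift ends in
   s e_j + b, with b independent of j and translation by b central in Gamma(A),
   so b is in L.  The period of the flux along e_j is the omega-area of the
   lifted square, since i_{X_t} omega is closed and may be integrated over
   s |-> phi_t(s e_j); by Stokes this area is omega(b, e_j).

   As omega pairs only coordinates with equal columns, its matrix maps R^J
   isomorphically onto itself, and L lies between Z^J and (1/2) Z^J. *)

Require Import Defs.
From HB Require Import structures.
From mathcomp Require Import all_boot all_order all_algebra.
From mathcomp Require Import all_classical all_reals all_analysis.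
From mathcomp Require Import ring lra.
Set Implicit Arguments.
Unset Strict Implicit.
Unset Printing Implicit Defensive.
Import Order.TTheory GRing.Theory Num.Theory.
Import numFieldNormedType.Exports.
Local Open Scope classical_set_scope.
Local Open Scope ring_scope.

(** * Integrals depending on a parameter *)

(** Two features of the setting shape the argument. First, local lifts are arbitrary up to Gamma(A),
    and both [preserves] and [generated_by] quantify over all of them, so lifts must constantly be
    compared. The tool for this is a rigidity fact: an element of Gamma(A) that moves some point by
    less than 1/2 in every coordinate is the identity. Two lifts of the same map that are close at a
    point therefore agree near it, and a continuous lift inherits the smoothness of local ones.
    Secondly, [generated_by] gives no regularity of [X] in time, and lifts are constrained only for
    times in [0, 1]. Regularity is therefore read off the smooth local lifts, [X] evaluated along
    the lift serves as its time derivative, and the fundamental theorem of calculus is applied with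
    continuity on [0, 1] and derivatives only in the interior. Stokes is carried out by hand on the
    square: a constant 2-form [om] on R^m has the primitive [om u du / 2], which is the origin of
    the factor 1/2 in the area formula. *)

Section PairContinuity.
Variables (T U W : topologicalType).

Lemma continuous_pair (f : T -> U) (g : T -> W) (x : T) :
  {for x, continuous f} -> {for x, continuous g} ->
  {for x, continuous (fun y => (f y, g y))}.
Proof. by move=> cf cg; exact: (cvg_pair cf cg). Qed.

Lemma continuous_fst : continuous (@fst T U).
Proof. by move=> z; exact: cvg_fst. Qed.

Lemma continuous_snd : continuous (@snd T U).
Proof. by move=> z; exact: cvg_snd. Qed.

End PairContinuity.

Section ParameterIntegrals.
Variable R : realType.
Notation mu := (@lebesgue_measure R).
Notation "\int01 f" := (\int[mu]_(s in `[0, 1]) f s) (at level 10, f at level 9).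

Lemma compact_rectangle_bound (K : R * R -> R) (a b c d : R) :
  (forall x s, x \in `[a, b] -> s \in `[c, d] -> {for (x, s), continuous K}) ->
  exists2 M, 0 <= M & forall x s, x \in `[a, b] -> s \in `[c, d] -> `|K (x, s)| <= M.
Proof.
move=> cK.
have /compact_bounded[M [_ KM]] : compact (K @` (`[a, b] `*` `[c, d])).
  apply: continuous_compact; last by apply: compact_setX; exact: segment_compact.
  apply: continuous_in_subspaceT => -[x s] /set_mem[/= xab scd].
  exact: cK.
exists (`|M| + 1) => [|x s xab scd]; first by rewrite addr_ge0.
apply: (KM (`|M| + 1)); first by rewrite (le_lt_trans (ler_norm M)) ?ltrDl.
by exists (x, s) => //; split.
Qed.

Lemma continuous_slice (T U W : topologicalType) (K : T * U -> W) x s :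
  {for (x, s), continuous K} -> {for s, continuous (fun s => K (x, s))}.
Proof.
move=> cK; apply: (@continuous_comp _ _ _ (fun s => (x, s)) K) => //.
by apply: cvg_pair => /=; [exact: cvg_cst|exact: cvg_id].
Qed.

Lemma continuous_slicel (T U W : topologicalType) (K : T * U -> W) x s :
  {for (x, s), continuous K} -> {for x, continuous (fun x => K (x, s))}.
Proof.
move=> cK; apply: (@continuous_comp _ _ _ (fun x => (x, s)) K) => //.
by apply: cvg_pair => /=; [exact: cvg_id|exact: cvg_cst].
Qed.

Lemma integrable01 (f : R -> R) :
  (forall s, s \in `[0, 1] -> {for s, continuous f}) ->
  mu.-integrable `[0, 1] (EFin \o f).
Proof.
move=> cf; apply: continuous_compact_integrable; first exact: segment_compact.
by apply: continuous_in_subspaceT => s /set_mem; exact: cf.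
Qed.

Lemma continuous_param (K : R * R -> R) (x0 : R) :
  (forall x s, s \in `[0, 1] -> {for (x, s), continuous K}) ->
  {for x0, continuous (fun x => \int01 (fun s => K (x, s)))}.
Proof.
move=> cK.
have [M M0 KM] := @compact_rectangle_bound K (x0 - 1) (x0 + 1) 0 1
  (fun x s _ => cK x s).
apply: (@continuity_under_integral _ _ _ mu (fun x s => K (x, s)) `[0, 1]
  _ (x0 - 1) (x0 + 1) _ _ (cst M)) => //.
- by move=> x _; apply: integrable01 => s s01; apply: continuous_slice; exact: cK.
- by apply: aeW => s s01 x _; apply: continuous_slicel; exact: cK.
- by apply: integrable01 => s _; exact: cst_continuous.
- move=> x /= /andP[x1 x2]; apply: aeW => s s01; apply: KM => //.
  by rewrite in_itv/= !ltW.
- by rewrite inE/= in_itv/=; lra.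
Qed.

Lemma derive_param (K K' : R * R -> R) (a b x0 : R) : x0 \in `]a, b[ ->
  (forall x s, x \in `]a, b[ -> s \in `[0, 1] ->
    [/\ {for s, continuous (fun s => K (x, s))},
        is_derive x 1 (fun x => K (x, s)) (K' (x, s)) &
        {for (x, s), continuous K'}]) ->
  is_derive x0 1 (fun x => \int01 (fun s => K (x, s))) (\int01 (fun s => K' (x0, s))).
Proof.
rewrite in_itv/= => /andP[ax0 x0b] hK.
(* [K'] is controlled only over the open interval. On the closed subinterval [[a', b']] around [x0]
   compactness bounds it by a constant, which dominates the difference quotients. *)
pose a' := (a + x0) / 2; pose b' := (b + x0) / 2.
have ab x : x \in `[a', b'] -> x \in `]a, b[.
  by rewrite !in_itv/= /a' /b'; lra.
have [M M0 KM] : exists2 M, 0 <= M & forall x s, x \in `[a', b'] ->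
    s \in `[0, 1] -> `|K' (x, s)| <= M.
  by apply: compact_rectangle_bound => x s /ab xab s01; have [] := hK _ _ xab s01.
have ab' x : x \in `]a', b'[ -> x \in `[a', b'].
  by rewrite !in_itv/= /a' /b'; lra.
have int x : `]a', b'[%classic x -> mu.-integrable `[0, 1] (EFin \o (fun s => K (x, s))).
  by move=> /ab'/ab xab; apply: integrable01 => s s01; have [] := hK _ _ xab s01.
have der (x s : R) : `]a', b'[%classic x -> `[0, 1]%classic s ->
    derivable (fun x => K (x, s)) x 1.
  by move=> /ab'/ab xab s01; have [_ []] := hK _ _ xab s01.
have derE (x s : R) : x \in `]a, b[ -> s \in `[0, 1] ->
    partial1of2 (fun x s => K (x, s)) x s = K' (x, s).
  move=> xab s01; rewrite partial1of2E.
  by have [_ /@derive_val] := hK _ _ xab s01.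
have bnd (x s : R) : `]a', b'[%classic x -> `[0, 1]%classic s ->
    `|partial1of2 (fun x s => K (x, s)) x s| <= M.
  by move=> xab s01; rewrite derE//; [apply/KM/s01/ab'|apply/ab/ab'].
have x0ab : `]a', b'[%classic x0 by rewrite /= in_itv/= /a' /b'; lra.
have iM : mu.-integrable `[0, 1] (EFin \o cst M).
  by apply: integrable01 => s _; exact: cst_continuous.
have m01 : measurable (`[0, 1]%classic : set R) by [].
apply: DeriveDef.
  exact: (derivable_under_integral (mu := mu) (f := fun x s => K (x, s))
    m01 x0ab int der (fun=> M0) iM bnd).
rewrite -derive1E (differentiation_under_integral (mu := mu) (f := fun x s => K (x, s))
  m01 x0ab int der (fun=> M0) iM bnd).
apply: eq_Rintegral => s; rewrite inE => s01.
by rewrite derE// in_itv/= ax0.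
Qed.

(** Derivatives are required in the interior only, because a lifted isotopy extended by constant
    times need not have a time derivative at 0 and 1. *)
Lemma FTC01 (f F : R -> R) : (forall s : R, s \in `[0, 1] -> {for s, continuous f}) ->
  (forall s : R, s \in `]0, 1[ -> is_derive s 1 F (f s)) ->
  (forall s : R, s \in `[0, 1] -> {for s, continuous F}) ->
  \int01 f = F 1 - F 0.
Proof.
move=> cf dF cF; rewrite /Rintegral (@continuous_FTC2 _ f F)//.
- by apply: continuous_in_subspaceT => s /set_mem; exact: cf.
- split=> [s s01||].
  + by have [] := dF s s01.
  + by apply: cvg_at_right_filter; apply: cF; rewrite in_itv/= lexx ler01.
  + by apply: cvg_at_left_filter; apply: cF; rewrite in_itv/= lexx ler01.
- by move=> s s01; rewrite derive1E; have /@derive_val := dF s s01.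
Qed.

Lemma Rintegral01_cst (r : R) : \int01 (cst r) = r.
Proof.
rewrite Rintegral_cst// -[RHS]mulr1; congr (_ * _).
have mu01 : mu `[0, 1]%classic = 1%E.
  by rewrite lebesgue_measure_itv/= lte_fin ltr01 -EFinB subr0.
exact: (congr1 fine mu01).
Qed.

End ParameterIntegrals.

(** * Calculus of C^k maps *)

Section Differentiability.
Variables (R : realType) (V W : normedModType R).
Implicit Types (f g : V -> W) (x v : V).

Lemma differentiable_estimate f x e : differentiable f x -> 0 < e ->
  \forall h \near 0, `|f (h + x) - f x - 'd f x h| <= e * `|h|.
Proof.
move=> /diff_locally/eqaddoP fx e0.
by near do rewrite -addrA -opprD; exact: (fx e e0).
Unshelve. all: by end_near. Qed.

Lemma estimate_differentiable f x (L : {linear V -> W}) : continuous L ->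
  (forall e, 0 < e -> \forall h \near 0, `|f (h + x) - f x - L h| <= e * `|h|) ->
  differentiable f x /\ 'd f x = L :> (V -> W).
Proof.
move=> cL fL.
have fE : f \o shift x = cst (f x) + L +o_ 0 id.
  apply/eqaddoP => e e0; near=> h; rewrite -[leLHS]/(`|f (h + x) - (f x + L h)|).
  by rewrite opprD addrA; near: h; exact: fL.
have dE := diff_unique cL fE.
by split=> //; apply/diff_locallyP; rewrite dE.
Unshelve. all: by end_near. Qed.

Lemma near_eq_differentiable f g x : {near x, f =1 g} ->
  differentiable f x -> differentiable g x.
Proof.
move=> fg df.
have fgx : f x = g x by apply: (nbhs_singleton fg).
apply: (@estimate_differentiable _ _ ('d f x) _ _).1 => [|e e0].
  exact: diff_continuous.
have fg0 : \forall h \near 0, f (h + x) = g (h + x).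
  by move/nbhs0P : fg => fg; near=> h; rewrite addrC; near: h.
near=> h.
rewrite -fgx -(near fg0 h)//; near: h; exact: differentiable_estimate.
Unshelve. all: by end_near. Qed.

Lemma differentiable_along f (x : R -> V) (t : R) (x' : V) :
  differentiable f (x t) -> is_derive t 1 x x' ->
  is_derive t 1 (f \o x) ('D_x' f (x t)).
Proof.
move=> df [dx <-].
have /derivable1_diffP dxt := dx.
apply: DeriveDef; first by apply/derivable1_diffP; exact: differentiable_comp.
rewrite deriveE; last exact: differentiable_comp.
by rewrite diff_comp//= [RHS]deriveE// [in RHS]deriveE.
Qed.

Lemma is_derive_parametrized_line x v (t : R) : is_derive t 1 (fun s => x + s *: v) v.
Proof.
have dv : differentiable (fun s : R => s *: v) t by exact: differentiableZl.
have idv : is_derive t 1 (fun s : R => s *: v) v.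
  apply: DeriveDef; first exact/derivable1_diffP.
  by rewrite deriveE// diffZl//= (@diff_val _ _ _ _ _ id id)// scale1r.
by have := is_deriveD (is_derive_cst x t 1) idv; rewrite add0r.
Qed.

Lemma is_derive_line f x v (t : R) : differentiable f (x + t *: v) ->
  is_derive t 1 (fun s => f (x + s *: v)) ('D_v f (x + t *: v)).
Proof.
move=> df; apply: (@differentiable_along f (fun s => x + s *: v)) => //.
exact: is_derive_parametrized_line.
Qed.

End Differentiability.

Section CkCalculus.
Variables (R : realType) (V W : normedModType R).
Implicit Types (U : set V) (k : nat).

Lemma Ck_on_sub U U' k (f : V -> W) : U' `<=` U -> Ck_on U k f -> Ck_on U' k f.
Proof.
move=> UU'; elim: k f => [|k IH] f /=; first by move=> cf x /UU'; exact: cf.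
by move=> [df Df]; split=> [x /UU'|v]; [exact: df|apply: IH].
Qed.

(** Openness turns equality on [U] into equality near each of its points, which is what passes to
    derivatives. *)
Lemma Ck_on_eq U k (f g : V -> W) : open U -> {in U, f =1 g} ->
  Ck_on U k f -> Ck_on U k g.
Proof.
move=> oU.
have near_U (x : V) (f' g' : V -> W) : U x -> {in U, f' =1 g'} -> {near x, f' =1 g'}.
  move=> Ux fg; have : nbhs x U by apply: open_nbhs_nbhs.
  by apply: filterS => y Uy; apply: fg; rewrite inE.
elim: k f g => [|k IH] f g fg /=.
  move=> cf x Ux; have fgx := near_U _ _ _ Ux fg.
  rewrite /prop_for /continuous_at -(nbhs_singleton fgx).
  by apply: cvg_trans (cf x Ux); exact: near_eq_cvg.
move=> [df Df]; split=> [x Ux|v].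
  exact/(near_eq_differentiable (near_U _ _ _ Ux fg))/df.
apply: IH (Df v) => x; rewrite inE => Ux.
by apply: near_eq_derive; exact: near_U fg.
Qed.

Lemma Ck_on_cst U k (b : W) : Ck_on U k (cst b).
Proof.
apply: (@Ck_on_sub setT) => //; case: k => [|k] /=.
  by move=> x _; exact: cst_continuous.
split=> [x _|v]; first exact: differentiable_cst.
rewrite (_ : (fun x => _) = 0); first exact: Ck_on0.
by apply/funext => x; rewrite derive_cst.
Qed.

End CkCalculus.

Section AffinePostcomposition.
Variables (R : realType) (V W W' : normedModType R).
Implicit Types (U : set V) (k : nat).

Lemma derive_affine (L : {linear W -> W'}) (b : W') (f : V -> W) x v :
  continuous L -> differentiable f x ->
  differentiable (fun y => L (f y) + b) x /\
  'D_v (fun y => L (f y) + b) x = L ('D_v f x).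
Proof.
move=> cL df.
have dLf : differentiable (L \o f) x.
  by apply: differentiable_comp => //; exact: linear_differentiable.
have dLb : differentiable ((L \o f) + cst b) x by exact: differentiableD.
split=> //; rewrite deriveE// diffD//= diff_cst addr0 diff_comp//=; last first.
  exact: linear_differentiable.
by rewrite diff_lin// -deriveE.
Qed.

Lemma Ck_on_affine U k (L : {linear W -> W'}) (b : W') (f : V -> W) :
  open U -> continuous L -> Ck_on U k f -> Ck_on U k (fun x => L (f x) + b).
Proof.
move=> oU cL; elim: k b f => [|k IH] b f /=.
  move=> cf x Ux; apply: continuousD; last exact: cst_continuous.
  by apply: (@continuous_comp _ _ _ f L); [exact: cf|exact: cL].
move=> [df Df]; split=> [x Ux|v]; first by have [] := derive_affine b 0 cL (df x Ux).
apply: (@Ck_on_eq _ _ _ _ _ (fun x => L ('D_v f x) + 0)) => //; last exact: IH.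
move=> x; rewrite inE => Ux; rewrite addr0.
by have [_ ->] := derive_affine b v cL (df x Ux).
Qed.

End AffinePostcomposition.

Lemma smooth_on_id (R : realType) (V : normedModType R) (U : set V) :
  smooth_on U (id : V -> V).
Proof.
case=> [|k] /=; first by move=> x _; exact: cvg_id.
split=> [x _|v]; first exact: ex_diff.
have -> : (fun x : V => 'D_v id x) = cst v by apply/funext => x; rewrite derive_id.
exact: Ck_on_cst.
Qed.

(** * Symmetry of second derivatives *)

Section SymmetricSecondDerivative.
Variables (R : realType) (V : normedModType R).
Implicit Types (f : V -> R) (U : set V).

Lemma MVT_is_derive (g dg : R -> R) (h : R) : 0 <= h ->
  (forall t : R, t \in `[0, h] -> is_derive t 1 g (dg t)) ->
  exists2 c, c \in `[0, h] & g h - g 0 = dg c * h.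
Proof.
move=> h0 dgP.
have dg0h (t : R) : t \in `]0, h[ -> is_derive t 1 g (dg t).
  by rewrite in_itv/= => /andP[/ltW t0 /ltW th]; apply: dgP; rewrite in_itv/= t0.
have cg : {within `[0, h], continuous g}.
  apply: continuous_in_subspaceT => t /set_mem /dgP[dt _].
  exact/differentiable_continuous/derivable1_diffP.
have [c ch] := @MVT_segment R g dg 0 h h0 dg0h cg.
by rewrite subr0 => gE; exists c.
Qed.

(** The mean value theorem is applied twice: along [v] to the difference of [f] between the two
    edges of the parallelogram, then along [w] to ['D_v f]. The left side is symmetric in [v] and
    [w], the right side is not. *)
Lemma second_difference f U x v w (h : R) : 0 <= h ->
  (forall a b, a \in `[0, h] -> b \in `[0, h] -> U (x + a *: v + b *: w)) ->
  (forall y, U y -> differentiable f y) ->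
  (forall y, U y -> differentiable (fun y => 'D_v f y) y) ->
  exists a b, [/\ a \in `[0, h], b \in `[0, h] &
    f (x + h *: v + h *: w) - f (x + h *: v) - (f (x + h *: w) - f x) =
    'D_w (fun y => 'D_v f y) (x + a *: v + b *: w) * h ^+ 2].
Proof.
move=> h0 Uxh df ddf.
have h0h : 0 \in `[0, h] by rewrite in_itv/= lexx.
have hh : h \in `[0, h] by rewrite in_itv/= h0 lexx.
pose g a := f (x + h *: w + a *: v) - f (x + a *: v).
have Ux a : a \in `[0, h] -> U (x + a *: v).
  by move=> ah; have := Uxh a 0 ah h0h; rewrite scale0r addr0.
have [a ah ga] := @MVT_is_derive g
  (fun a => 'D_v f (x + h *: w + a *: v) - 'D_v f (x + a *: v)) h h0
  (fun a ah => is_deriveB (is_derive_line (df _ (eq_ind _ U (Uxh _ _ ah hh) _ (addrAC _ _ _))))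
     (is_derive_line (df _ (Ux a ah)))).
have [b bh gb] := @MVT_is_derive (fun b => 'D_v f (x + a *: v + b *: w))
  (fun b => 'D_w (fun y => 'D_v f y) (x + a *: v + b *: w)) h h0
  (fun b bh => is_derive_line (ddf _ (Uxh _ _ ah bh))).
exists a, b; split=> //.
rewrite expr2 mulrA -gb scale0r addr0 [x + a *: v + _]addrAC -ga /g.
by rewrite !scale0r !addr0 [x + h *: w + _]addrAC; ring.
Qed.

(** The same second difference equals either mixed derivative, each at some point of a small
    parallelogram. By continuity both values are close to those at [x], so these cannot differ. *)
Lemma derive_swap f U x v w : open U -> Ck_on U 2 f -> U x ->
  'D_w (fun y => 'D_v f y) x = 'D_v (fun y => 'D_w f y) x.
Proof.
move=> oU [df Df] Ux.
have [dvf /(_ w) cvw] := Df v; have [dwf /(_ v) cwv] := Df w.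
pose D1 y := 'D_w (fun y => 'D_v f y) y; pose D2 y := 'D_v (fun y => 'D_w f y) y.
have c1 : {for x, continuous D1} := cvw x Ux.
have c2 : {for x, continuous D2} := cwv x Ux.
have second1 h : 0 <= h ->
  (forall a b, a \in `[0, h] -> b \in `[0, h] -> U (x + a *: v + b *: w)) ->
  exists a b, [/\ a \in `[0, h], b \in `[0, h] &
    f (x + h *: v + h *: w) - f (x + h *: v) - (f (x + h *: w) - f x) =
    D1 (x + a *: v + b *: w) * h ^+ 2].
  by move=> h0 Uh; exact: second_difference Uh df dvf.
have second2 h : 0 <= h ->
  (forall a b, a \in `[0, h] -> b \in `[0, h] -> U (x + a *: w + b *: v)) ->
  exists a b, [/\ a \in `[0, h], b \in `[0, h] &
    f (x + h *: w + h *: v) - f (x + h *: w) - (f (x + h *: v) - f x) =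
    D2 (x + a *: w + b *: v) * h ^+ 2].
  by move=> h0 Uh; exact: second_difference Uh df dwf.
rewrite -/(D1 x) -/(D2 x).
clearbody D1 D2; clear cvw cwv dvf dwf df Df.
apply: contrapT => /eqP neq.
pose e := `|D1 x - D2 x| / 2.
have e0 : 0 < e by rewrite divr_gt0// normr_gt0 subr_eq0.
have : \forall y \near x, [/\ U y, `|D1 x - D1 y| < e & `|D2 x - D2 y| < e].
  have nU : nbhs x U by exact: open_nbhs_nbhs.
  have /cvgrPdist_lt/(_ e e0) n1 := c1.
  have /cvgrPdist_lt/(_ e e0) n2 := c2.
  by apply: filterS3 nU n1 n2 => y.
move=> /nbhs_normP[r /= r0 xr].
(* This side length keeps the parallelogram in the ball of radius [r]; the [+ 1] covers
   [v = w = 0]. *)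
pose h := r / (`|v| + `|w| + 1).
have N0 : 0 < `|v| + `|w| + 1 by rewrite ltr_wpDl// addr_ge0.
have h0 : 0 < h by rewrite divr_gt0.
have rh a b v' w' : `|v'| + `|w'| = `|v| + `|w| -> a \in `[0, h] -> b \in `[0, h] ->
    `|x - (x + a *: v' + b *: w')| < r.
  move=> vw; rewrite !in_itv/= => /andP[a0 ah] /andP[b0 bh].
  rewrite -addrA opprD addNKr normrN (le_lt_trans (ler_normD _ _))// !normrZ !ger0_norm//.
  apply: (@le_lt_trans _ _ (h * (`|v'| + `|w'|))); first by rewrite mulrDr lerD// ler_wpM2r.
  by rewrite vw mulrAC ltr_pdivrMr// ltr_pM2l// ltrDl.
have U1 a b : a \in `[0, h] -> b \in `[0, h] -> U (x + a *: v + b *: w).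
  by move=> ah bh; have [] := xr _ (rh a b v w erefl ah bh).
have U2 a b : a \in `[0, h] -> b \in `[0, h] -> U (x + a *: w + b *: v).
  by move=> ah bh; have [] := xr _ (rh a b w v (addrC _ _) ah bh).
have [a [b [ah bh eqvw]]] := second1 h (ltW h0) U1.
have [a' [b' [ah' bh' eqwv]]] := second2 h (ltW h0) U2.
have h2 : h ^+ 2 != 0 by rewrite expf_neq0// gt_eqF.
have eqD : D1 (x + a *: v + b *: w) = D2 (x + a' *: w + b' *: v).
  apply: (mulIf h2); rewrite -eqvw -eqwv [x + h *: w + _]addrAC.
  by ring.
have [_ lt1 _] := xr _ (rh a b v w erefl ah bh).
have [_ _ lt2] := xr _ (rh a' b' w v (addrC _ _) ah' bh').
suff : `|D1 x - D2 x| < e + e by rewrite /e -splitr ltxx.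
rewrite -(subrKA (D1 (x + a *: v + b *: w))).
by rewrite (le_lt_trans (ler_normD _ _))// ltrD// distrC eqD.
Qed.

End SymmetricSecondDerivative.

Section ZeroGradient.
Variables (R : realType) (V : normedModType R).

Lemma zero_gradient (f : V -> R) : (forall x, differentiable f x) ->
  (forall x v, 'D_v f x = 0) -> forall x y, f x = f y.
Proof.
move=> df Df x y.
have [|c _] := @MVT_is_derive _ (fun t => f (y + t *: (x - y)))
  (fun t => 'D_(x - y) f (y + t *: (x - y))) 1 ler01.
  by move=> t _; exact: is_derive_line.
by rewrite Df mul0r scale1r scale0r addr0 subrKC => /subr0_eq.
Qed.

End ZeroGradient.

Lemma continuous_sum (R : realType) (T : topologicalType) (W : normedModType R)
    (I : Type) (r : seq I) (P : pred I) (f : I -> T -> W) (x : T) :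
  (forall i, {for x, continuous (f i)}) ->
  {for x, continuous (fun y => \sum_(i <- r | P i) f i y)}.
Proof.
move=> cf; elim: r => [|i r IH].
  have -> : (fun y => \sum_(i <- [::] | P i) f i y) = cst 0.
    by apply/funext => y; rewrite big_nil.
  exact: cst_continuous.
have -> : (fun y => \sum_(j <- i :: r | P j) f j y) =
    (if P i then f i else cst 0) + (fun y => \sum_(j <- r | P j) f j y).
  by apply/funext => y; rewrite big_cons !fctE; case: (P i); rewrite ?add0r.
by apply: continuousD => //; case: (P i) => //; exact: cst_continuous.
Qed.

(** * Row vectors, coordinate by coordinate *)

Section RowVectors.
Variables (R : realType) (m : nat).

Lemma row_coord_le (v : 'rV[R]_m) j : `|v 0 j| <= `|v|.
Proof.
rewrite [leRHS]/Num.Def.normr/= mx_normrE.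
by apply: (le_trans _ (le_bigmax _ _ (0, j))).
Qed.

Lemma continuous_coord (T : topologicalType) (f : T -> 'rV[R]_m) (x : T) j :
  {for x, continuous f} -> {for x, continuous (fun y => f y 0 j)}.
Proof.
by move=> cf; apply: (@continuous_comp _ _ _ f (fun u : 'rV[R]_m => u 0 j)) => //;
  exact: coord_continuous.
Qed.

Lemma is_derive_coord (V : normedModType R) (f : V -> 'rV[R]_m) x v (f' : 'rV[R]_m) j :
  is_derive x v f f' -> is_derive x v (fun y => f y 0 j) (f' 0 j).
Proof.
move=> [df <-]; apply: DeriveDef; first by have /derivable_mxP := df; apply.
by rewrite derive_mx// mxE.
Qed.

Lemma is_derive_row (V : normedModType R) (f : V -> 'rV[R]_m) x v (f' : 'rV[R]_m) :
  (forall j, is_derive x v (fun y => f y 0 j) (f' 0 j)) -> is_derive x v f f'.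
Proof.
move=> dfj; have df : derivable f x v.
  by apply/derivable_mxP => i j; rewrite ord1; have [] := dfj j.
apply: DeriveDef => //; rewrite derive_mx//; apply/rowP => j.
by rewrite mxE; have /@derive_val := dfj j.
Qed.

Lemma mulmx_continuous n (M : 'M[R]_(m, n)) : continuous (fun v : 'rV[R]_m => v *m M).
Proof.
move=> v; have -> : (fun v : 'rV[R]_m => v *m M) = fun v => \sum_i v 0 i *: row i M.
  by apply/funext => u; rewrite mulmx_sum_row.
by apply: continuous_sum => i; apply: continuousZl; exact: coord_continuous.
Qed.

End RowVectors.

(** * The area swept by a periodic curve *)

Section Bilinear.
Variables (R : realType) (m : nat).
Implicit Types (Om : 'M[R]_m) (u v w : 'rV[R]_m).

Lemma pairingDl u v w : pairing (u + v) w = pairing u w + pairing v w.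
Proof. by rewrite /pairing -big_split; apply: eq_bigr => j _; rewrite mxE mulrDl. Qed.

Lemma pairing0l u : pairing 0 u = 0.
Proof. by rewrite /pairing big1// => j _; rewrite mxE mul0r. Qed.

Lemma pairingDr u v w : pairing u (v + w) = pairing u v + pairing u w.
Proof. by rewrite /pairing -big_split; apply: eq_bigr => j _; rewrite mxE mulrDr. Qed.

Lemma pairingZl (a : R) u v : pairing (a *: u) v = a * pairing u v.
Proof. by rewrite /pairing mulr_sumr; apply: eq_bigr => j _; rewrite mxE mulrA. Qed.

Lemma pairingZr (a : R) u v : pairing u (a *: v) = a * pairing u v.
Proof. by rewrite /pairing mulr_sumr; apply: eq_bigr => j _; rewrite mxE mulrCA. Qed.

Lemma pairingC u v : pairing u v = pairing v u.
Proof. by apply: eq_bigr => j _; rewrite mulrC. Qed.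

Lemma pairingBr u v w : pairing u (v - w) = pairing u v - pairing u w.
Proof. by rewrite pairingDr -scaleN1r pairingZr mulN1r. Qed.

Lemma pairing_mx u v : pairing u v = (u *m v^T) 0 0.
Proof. by rewrite mxE; apply: eq_bigr => j _; rewrite !mxE. Qed.

Lemma pairing_delta u j : pairing u 'e_j = u 0 j.
Proof.
rewrite /pairing (bigD1 j)//= big1 ?addr0 => [|k kj]; first by rewrite !mxE !eqxx mulr1.
by rewrite !mxE (negPf kj) andbF mulr0.
Qed.

Lemma pairing_skew Om u v : Om^T = - Om ->
  pairing (u *m Om) v = - pairing (v *m Om) u.
Proof.
move=> sk; rewrite !pairing_mx.
have -> : v *m Om *m u^T = (u *m Om^T *m v^T)^T by rewrite !trmx_mul !trmxK mulmxA.
by rewrite sk mulmxN mulNmx [in RHS]mxE [in RHS]mxE opprK.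
Qed.

Lemma continuous_pairing (T : topologicalType) (f g : T -> 'rV[R]_m) (x : T) :
  {for x, continuous f} -> {for x, continuous g} ->
  {for x, continuous (fun y => pairing (f y) (g y))}.
Proof.
move=> cf cg; apply: (@continuous_sum R _ R) => j.
by apply: continuousM; exact: continuous_coord.
Qed.

Lemma is_derive_sum_fun (V W : normedModType R) n (f : 'I_n -> V -> W) (f' : 'I_n -> W) (x v : V) :
  (forall i, is_derive x v (f i) (f' i)) ->
  is_derive x v (fun y => \sum_i f i y) (\sum_i f' i).
Proof.
move=> df; rewrite (_ : (fun y => _) = \sum_i f i); last first.
  by apply/funext => y; rewrite fct_sumE.
exact: is_derive_sum.
Qed.

Lemma is_derive_pairing (V : normedModType R) (f g : V -> 'rV[R]_m) (x v : V)
    (f' g' : 'rV[R]_m) : is_derive x v f f' -> is_derive x v g g' ->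
  is_derive x v (fun y => pairing (f y) (g y)) (pairing f' (g x) + pairing (f x) g').
Proof.
move=> df dg; rewrite /pairing -big_split; apply: is_derive_sum_fun => j /=.
have dfj := is_derive_coord j df; have dgj := is_derive_coord j dg.
by apply: is_derive_eq; rewrite addrC [f' 0 j * _]mulrC.
Qed.

Lemma is_derive_mulmx (V : normedModType R) (f : V -> 'rV[R]_m) (x v : V) (f' : 'rV[R]_m) Om :
  is_derive x v f f' -> is_derive x v (fun y => f y *m Om) (f' *m Om).
Proof.
move=> df; apply: is_derive_row => j.
rewrite (_ : (fun y => _) = fun y => \sum_i f y 0 i * Om i j); last first.
  by apply/funext => y; rewrite mxE.
rewrite mxE; apply: is_derive_sum_fun => i; have dfi := is_derive_coord i df.
by apply: is_derive_eq; rewrite scaler0 add0r mulrC.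
Qed.

Lemma continuous_mulmx (T : topologicalType) (f : T -> 'rV[R]_m) (x : T) Om :
  {for x, continuous f} -> {for x, continuous (fun y => f y *m Om)}.
Proof.
move=> cf.
have cM : {for f x, continuous (fun u : 'rV[R]_m => u *m Om)}.
  exact: (@mulmx_continuous R m m Om (f x)).
exact: (continuous_comp cf cM).
Qed.

End Bilinear.

Section SweptArea.
Variables (R : realType) (m : nat) (Om : 'M[R]_m).
Notation mu := (@lebesgue_measure R).
Notation "\int01 f" := (\int[mu]_(s in `[0, 1]) f s) (at level 10, f at level 9).
Local Notation om v w := (pairing (v *m Om) w).

Lemma continuous_om (T : topologicalType) (f g : T -> 'rV[R]_m) (x : T) :
  {for x, continuous f} -> {for x, continuous g} ->
  {for x, continuous (fun y => om (f y) (g y))}.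
Proof. by move=> cf cg; exact: (continuous_pairing (continuous_mulmx cf) cg). Qed.

Lemma is_derive_om (V : normedModType R) (f g : V -> 'rV[R]_m) (x v : V)
    (f' g' : 'rV[R]_m) : is_derive x v f f' -> is_derive x v g g' ->
  is_derive x v (fun y => om (f y) (g y)) (om f' (g x) + om (f x) g').
Proof. by move=> df dg; exact: (is_derive_pairing (is_derive_mulmx Om df) dg). Qed.

(* Stokes on the square for the constant form [om]: both sides of the strip are
   identified by the translation [e], so only [t = 0] and [t = 1] contribute. *)
Lemma swept_area (F Fs Ft Fst : R * R -> 'rV[R]_m) (e : 'rV[R]_m) :
  Om^T = - Om ->
  (forall t s : R, s \in `[0, 1] -> [/\ {for (t, s), continuous F},
     {for (t, s), continuous Fs} & {for (t, s), continuous Ft}]) ->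
  (forall t s : R, t \in `]0, 1[ -> s \in `[0, 1] ->
     [/\ is_derive t 1 (fun t => F (t, s)) (Ft (t, s)),
         is_derive t 1 (fun t => Fs (t, s)) (Fst (t, s)),
         is_derive s 1 (fun s => F (t, s)) (Fs (t, s)),
         is_derive s 1 (fun s => Ft (t, s)) (Fst (t, s)) &
         {for (t, s), continuous Fst}]) ->
  (forall t, F (t, 1) = F (t, 0) + e) ->
  let B t := (\int01 (fun s => om (F (t, s)) (Fs (t, s))) - om e (F (t, 0))) / 2 in
  \int01 (fun t => \int01 (fun s => om (Ft (t, s)) (Fs (t, s)))) = B 1 - B 0.
Proof.
move=> sk cF dF Fe B.
have s0 : 0 \in `[0, 1 : R] by rewrite in_itv/= lexx ler01.
have s1 : 1 \in `[0, 1 : R] by rewrite in_itv/= lexx ler01.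
have int_om (G H : R * R -> 'rV[R]_m) t :
    (forall s : R, s \in `[0, 1] -> {for (t, s), continuous G}) ->
    (forall s : R, s \in `[0, 1] -> {for (t, s), continuous H}) ->
    mu.-integrable `[0, 1] (EFin \o (fun s => om (G (t, s)) (H (t, s)))).
  move=> cG cH; apply: integrable01 => s s01.
  by apply: continuous_om; apply: continuous_slice; [exact: cG|exact: cH].
have cE t : {for t, continuous (fun t => \int01 (fun s => om (F (t, s)) (Fs (t, s))))}.
  apply: (@continuous_param _ (fun z => om (F z) (Fs z))) => x s s01.
  by have [? ? ?] := cF x s s01; exact: continuous_om.
apply: FTC01 => t t01.
- apply: (@continuous_param _ (fun z => om (Ft z) (Fs z))) => x s s01.
  by have [? ? ?] := cF x s s01; exact: continuous_om.
- have dE : is_derive t 1 (fun t => \int01 (fun s => om (F (t, s)) (Fs (t, s))))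
      (\int01 (fun s => om (Ft (t, s)) (Fs (t, s)) + om (F (t, s)) (Fst (t, s)))).
    apply: (@derive_param _ (fun z => om (F z) (Fs z))
      (fun z => om (Ft z) (Fs z) + om (F z) (Fst z)) 0 1) => // x s x01 s01.
    have [cFx cFsx cFtx] := cF x s s01; have [d1 d2 _ _ c3] := dF x s x01 s01.
    split; last by apply: continuousD; exact: continuous_om.
    + by apply: continuous_om; exact: continuous_slice.
    + exact: is_derive_om.
  (* By skewness the integrand is the [s]-derivative of [om F Ft]. The mixed term in [dE] thus
     yields a second copy of the area and the boundary term [om e (Ft (t, 0))]; [B] subtracts a
     primitive of the latter and halves. *)
  have byparts : \int01 (fun s => om (F (t, s)) (Fst (t, s)) - om (Ft (t, s)) (Fs (t, s))) =
      om (F (t, 1)) (Ft (t, 1)) - om (F (t, 0)) (Ft (t, 0)).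
    apply: (@FTC01 _ _ (fun s => om (F (t, s)) (Ft (t, s)))) => s s01.
    + have [cFx cFsx cFtx] := cF t s s01; have [_ _ _ _ c3] := dF t s t01 s01.
      by apply: continuousB; apply: continuous_om; exact: continuous_slice.
    + have s01' : s \in `[0, 1] by move: s01; rewrite !in_itv/= => /andP[/ltW-> /ltW->].
      have [_ _ d3 d4 _] := dF t s t01 s01'.
      by rewrite -(pairing_skew _ _ sk) addrC; exact: is_derive_om.
    + have [cFx cFsx cFtx] := cF t s s01.
      by apply: continuous_om; exact: continuous_slice.
  have Ft1 : Ft (t, 1) = Ft (t, 0).
    have [/@derive_val <- _ _ _ _] := dF t 1 t01 s1.
    have [d0 _ _ _ _] := dF t 0 t01 s0.
    rewrite (_ : (fun t => F (t, 1)) = (fun t => F (t, 0)) + cst e); last first.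
      by apply/funext => x; rewrite Fe.
    by have [_ ->] := is_deriveD d0 (is_derive_cst e t 1); rewrite addr0.
  have [d0 _ _ _ _] := dF t 0 t01 s0.
  have dB := is_derive_om (is_derive_cst e t 1) d0.
  have iFtFs : mu.-integrable `[0, 1] (EFin \o (fun s => om (Ft (t, s)) (Fs (t, s)))).
    by apply: int_om => s s01; have [] := cF t s s01.
  have iFFst : mu.-integrable `[0, 1] (EFin \o (fun s => om (F (t, s)) (Fst (t, s)))).
    by apply: int_om => s s01; [have [] := cF t s s01|have [] := dF t s t01 s01].
  rewrite RintegralB// in byparts; rewrite RintegralD// in dE; move: byparts dE.
  rewrite Ft1 Fe mulmxDl pairingDl.
  set I1 := \int[mu]_(_ in _) _; set I2 := \int[mu]_(_ in _) _ => byparts dE.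
  have dB' := is_deriveZ 2^-1 (is_deriveB dE dB).
  have -> : B = 2^-1 \*: ((fun t => \int01 (fun s => om (F (t, s)) (Fs (t, s)))) -
      (fun t => om (cst e t) (F (t, 0)))).
    by apply/funext => x; rewrite /B mulrC.
  apply: (is_derive_eq dB'); rewrite mul0mx pairing0l add0r.
  have {byparts}-> : I1 = I2 + om e (Ft (t, 0)) by rewrite -[I1](subrK I2) byparts; ring.
  by rewrite /GRing.scale/=; field.
- have -> : B = 2^-1 \*: ((fun t => \int01 (fun s => om (F (t, s)) (Fs (t, s)))) -
      (fun t => om (cst e t) (F (t, 0)))).
    by apply/funext => x; rewrite /B mulrC.
  apply: continuousZr; apply: continuousB; first exact: cE.
  have [cF0 _ _] := cF t 0 s0.
  by apply: continuous_om; [exact: cst_continuous|exact: (continuous_slicel cF0)].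
Qed.

End SweptArea.

(** * The transformation group Gamma(A) *)

Section GammaStructure.
Variables (R : realType) (m : nat) (A : 'M[bool]_m).
Hypothesis hA : bott_matrix A.
Local Notation V := 'rV[R]_m.
Local Notation Gamma := (@Gamma R m A).
Local Notation pr := (@pr R m A).
Implicit Types (g : V -> V) (u v p q : V) (z : 'I_m -> int).

(* Every element of Gamma(A) is a [bott_affine z]; its linear part is determined
   by the parities of the half-integer translation vector [z / 2]. *)
Definition column_sign z (j : 'I_m) : int := \prod_(k | A k j) (-1) ^ (z k).

Definition bott_affine z u : V :=
  \row_j ((column_sign z j)%:~R * u 0 j + (z j)%:~R / 2).

Lemma expN1z (x : int) : ((-1) ^ x : int) = 1 \/ ((-1) ^ x : int) = -1.
Proof.
have H (n : nat) : ((-1) ^+ n : int) = 1 \/ ((-1) ^+ n : int) = -1.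
  by rewrite -signr_odd; case: odd; [right|left]; rewrite ?expr1 ?expr0.
case: x => n; first exact: H.
by rewrite NegzE -invr_expz -exprnP; case: (H n.+1) => ->; [left|right].
Qed.

Lemma column_signP z j : column_sign z j = 1 \/ column_sign z j = -1.
Proof.
rewrite /column_sign; elim/big_ind: _ => [|x y [] -> [] ->|k _]; rewrite ?mulr1 ?mulrNN ?mul1r.
all: try by [left|right].
exact: expN1z.
Qed.

Lemma expN1_sign (x y : int) : y = 1 \/ y = -1 -> ((-1) ^ (y * x) : int) = (-1) ^ x.
Proof.
case=> ->; first by rewrite mul1r.
by rewrite mulN1r -invr_expz; case: (expN1z x) => ->.
Qed.

(** Signs do not change parities, so linear parts multiply although translation vectors compose with
    a twist. *)
Lemma column_signM z z' y j : (forall k, y k = 1 \/ y k = -1) ->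
  column_sign (fun k => y k * z' k + z k) j = column_sign z j * column_sign z' j.
Proof.
move=> yP; rewrite /column_sign -big_split; apply: eq_bigr => k _ /=.
by rewrite exprzDr ?unitrN1// expN1_sign// mulrC.
Qed.

Lemma column_sign0 j : column_sign (fun=> 0) j = 1.
Proof. by rewrite /column_sign big1. Qed.

Lemma Gamma_bott_affine g : Gamma g -> exists z, g = bott_affine z.
Proof.
elim=> [i||f f' _ [z ->] _ [z' ->]|f f' _ [z ->] fK f'K].
- exists (fun k => (k == i)%:R); apply/funext => u; apply/rowP => j; rewrite !mxE.
  have -> : column_sign (fun k => (k == i)%:R) j = (-1) ^+ (A i j).
    rewrite /column_sign; case: (boolP (A i j)) => Aij.
      rewrite (bigD1 i)//= eqxx big1 ?mulr1// => k /andP[_ /negPf->].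
      by rewrite expr0z.
    by rewrite big1// => k Akj; case: eqP Akj Aij => [->->//|_]; rewrite expr0z.
  rewrite rmorphXn/= rmorphN1.
  case: ltngtP => ij; last 2 first.
  + have -> : (j == i) = false by rewrite -val_eqE; case: ltngtP ij.
    by rewrite mul0r addr0.
  + have -> : j = i by exact: val_inj.
    by rewrite eqxx hA// expr0 mul1r mul1r.
  have -> : (j == i) = false by rewrite -val_eqE; case: ltngtP ij.
  by rewrite hA 1?ltnW// expr0 mul1r mul0r addr0.
- exists (fun=> 0); apply/funext => u; apply/rowP => j.
  by rewrite !mxE column_sign0 mul1r mul0r addr0.
- exists (fun k => column_sign z k * z' k + z k).
  apply/funext => u; apply/rowP => j; rewrite !mxE column_signM; last exact: column_signP.
  by rewrite !(rmorphM, rmorphD)/=; ring.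
(* The inverse of a map with sign [e = 1] or [-1] and translation [z / 2] has the same sign and
   translation [- e z / 2]; the [+ 0] gives the shape of [column_signM]. *)
- exists (fun k => (- column_sign z k) * z k + 0).
  apply/funext => v; rewrite -{2}(f'K v); apply/rowP => j.
  rewrite !mxE column_signM; last by move=> k; case: (column_signP z k) => ->; [right|left].
  rewrite column_sign0 mul1r !(rmorphM, rmorphD, rmorphN)/=.
  by case: (column_signP z j) => ->; rewrite ?rmorphN1 ?rmorph1; ring.
Qed.

(* The first coordinate [k] with [z k != 0] has trivial sign, since [A] is
   strictly upper triangular, so [g] moves it by [z k / 2]. *)
Lemma Gamma_near_id g p : Gamma g -> (forall j, `|g p 0 j - p 0 j| < 2^-1) -> g = id.
Proof.
move=> /Gamma_bott_affine[z ->] gp.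
have z0 j : z j = 0.
  elim/ltn_ind: {j}(val j) {-2}j (erefl (val j)) => n IH j jn.
  have s1 : column_sign z j = 1.
    rewrite /column_sign big1// => k Akj; rewrite (IH k) ?expr0z// -jn ltnNge.
    by apply/negP => /hA; rewrite Akj.
  have := gp j; rewrite !mxE s1 mul1r addrAC subrr add0r normrM [`|2^-1|]ger0_norm//.
  rewrite -intr_norm ltr_pdivrMr// mulVf// ltrz1.
  by case: (z j) => [[|[|k]]|[|k]].
apply/funext => u; apply/rowP => j; rewrite mxE z0 mul0r addr0.
by rewrite /column_sign big1 ?mul1r// => k _; rewrite z0 expr0z.
Qed.

Lemma pr_eqP p q : pr p = pr q <-> exists2 g, Gamma g & q = g p.
Proof. by split=> [/eqquotP/asboolP//|gq]; apply/eqquotP/asboolP. Qed.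

Lemma pr_Gamma g p : Gamma g -> pr (g p) = pr p.
Proof. by move=> Gg; apply/esym/pr_eqP; exists g. Qed.

Lemma Gamma_free g g' p : Gamma g -> Gamma g' -> g p = g' p -> g = g'.
Proof.
move=> Gg Gg' gp; have [h' hK h'K] := Gamma_bij Gg'.
have Gh := Gamma_comp (Gamma_inv Gg' hK h'K) Gg.
have hid : h' \o g = id.
  by apply: (@Gamma_near_id _ p) => // j; rewrite /= gp hK subrr normr0.
by apply/funext => u; rewrite -[LHS]h'K -[h' (g u)]/((h' \o g) u) hid.
Qed.

(** Distinct points of one orbit are at least 1/2 apart in the sup norm. This uniform gap takes the
    place of evenly covered neighbourhoods in the lifting arguments. *)
Lemma pr_gap g p q : Gamma g -> pr p = pr q -> `|p - g q| < 2^-1 -> p = g q.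
Proof.
move=> Gg /pr_eqP[f Gf qE] pgq.
have Ggf := Gamma_comp Gg Gf.
suff gf : g \o f = id by rewrite qE -[RHS]/((g \o f) p) gf.
apply: (@Gamma_near_id _ p) => // j; rewrite /= -qE distrC.
by apply: le_lt_trans pgq; have := row_coord_le (p - g q) j; rewrite !mxE.
Qed.

Lemma Gamma_affineP g : Gamma g -> exists d b : V,
  [/\ forall u, g u = u *m diag_mx d + b,
      forall j, d 0 j ^+ 2 = 1,
      forall j k, col j A = col k A -> d 0 j = d 0 k,
      forall j, (forall i, ~~ A i j) -> d 0 j = 1 &
      forall j, exists z : int, b 0 j = z%:~R / 2].
Proof.
move=> /Gamma_bott_affine[z ->].
exists (\row_j (column_sign z j)%:~R), (\row_j ((z j)%:~R / 2)); split=> [u|j|j k jk|j Aj|j].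
- by apply/rowP => j; rewrite mul_mx_diag !mxE mulrC.
- by rewrite mxE; case: (column_signP z j) => ->; rewrite ?rmorphN1 ?sqrrN expr1n.
- rewrite !mxE /column_sign; congr (_%:~R); apply: eq_bigl => i.
  by have /colP/(_ i) := jk; rewrite !mxE.
- by rewrite mxE /column_sign big_pred0// => i; apply/negbTE.
- by exists (z j); rewrite mxE.
Qed.

Lemma s_comp_s (j : 'I_m) (u : V) : s_ A j (s_ A j u) = u + 'e_j.
Proof.
apply/rowP => k; rewrite !mxE/=; have [ki|ik|/val_inj->] := ltngtP k j.
- by rewrite -val_eqE ltn_eqF// addr0.
- by rewrite -val_eqE gtn_eqF// addr0 mulrA -expr2 sqrr_sign mul1r.
- by rewrite eqxx mulr1n; field.
Qed.

Lemma Gamma_translation_delta (j : 'I_m) : Gamma (fun u => u + 'e_j).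
Proof.
rewrite (_ : (fun u => _) = s_ A j \o s_ A j).
  exact: Gamma_comp (Gamma_gen R A j) (Gamma_gen R A j).
by apply/funext => u; rewrite /= s_comp_s.
Qed.

End GammaStructure.

(** * Lifting squares to R^m *)

Section Clamp.
Variable R : realType.
Implicit Types a b x : R.

Definition clamp a b x : R := Num.max a (Num.min x b).

Lemma clamp_itv a b x : a <= b -> clamp a b x \in `[a, b].
Proof.
by move=> ab; rewrite in_itv/= /clamp le_max lexx/= ge_max ab ge_min lexx orbT.
Qed.

Lemma clamp_id a b x : x \in `[a, b] -> clamp a b x = x.
Proof. by rewrite in_itv/= /clamp => /andP[ax xb]; rewrite min_l// max_r. Qed.

Lemma clamp_continuous a b : continuous (clamp a b).
Proof.
move=> x; apply: (@continuous_max R R (cst a) (fun x => Num.min x b)).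
  exact: cst_continuous.
by apply: (@continuous_min R R id (cst b)); [exact: cvg_id|exact: cst_continuous].
Qed.

(** Compactness of [[a, b]] as an induction principle: the supremum of the [x] with [P a x] can be
    passed unless it is [b]. *)
Lemma interval_cover_ind (P : R -> R -> Prop) a b : a <= b ->
  (forall x : R, x \in `[a, b] -> exists2 e, 0 < e & forall c d : R,
     a <= c -> c <= d -> d <= b -> x - e < c -> d < x + e -> P c d) ->
  (forall c d e : R, a <= c -> c <= d -> d <= e -> e <= b -> P c d -> P d e -> P c e) ->
  P a b.
Proof.
move=> ab loc glue.
pose S := [set x | a <= x <= b /\ P a x].
have Sa : S a.
  split; first by rewrite lexx.
  have [|e e0 Pe] := loc a; first by rewrite in_itv/= lexx.
  by apply: Pe => //; rewrite ?ltrDl// ltrBlDr ltrDl.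
have supS : has_sup S by split; [exists a|exists b => x [/andP[]]].
have aS : a <= sup S by exact: sup_upper_bound.
have Sb : sup S <= b by apply: sup_le_ub; [exists a|move=> x [/andP[]]].
have [|e e0 Pe] := loc (sup S); first by rewrite in_itv/= aS.
have [x [/andP[ax xb] Pax] xS] := sup_adherent e0 supS.
have xsup : x <= sup S by apply: sup_upper_bound => //; split=> //; rewrite ax.
(* [y] would exceed the supremum by [e / 2] unless capped; since [y] lies in [S], the cap [b] is
   attained. *)
pose y := Num.min b (sup S + e / 2).
have e20 : 0 < e / 2 by rewrite divr_gt0.
have supy : sup S <= y by rewrite le_min Sb lerDl ltW.
have yb : y <= b by rewrite ge_min lexx.
have xy : x <= y := le_trans xsup supy.
have Pay : P a y.
  apply: (glue a x y) => //; apply: Pe => //.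
  rewrite (@le_lt_trans _ _ (sup S + e / 2)) ?ge_min ?lexx ?orbT// ltrD2l.
  by rewrite ltr_pdivrMr// ltr_pMr// ltr1n.
have ysup : y <= sup S.
  by apply: sup_upper_bound => //; split=> //; rewrite yb (le_trans ax xy).
have : y = b.
  by move: ysup; rewrite /y; case: (leP b (sup S + e / 2)) => // _; lra.
by move=> <-.
Qed.

End Clamp.

Section Lifting.
Variables (R : realType) (m : nat) (A : 'M[bool]_m).
Hypothesis hA : bott_matrix A.
Local Notation V := 'rV[R]_m.
Local Notation M := (bott_manifold R A).
Local Notation Gamma := (@Gamma R m A).
Local Notation pr := (@pr R m A).

Lemma Gamma_continuous (g : V -> V) : Gamma g -> continuous g.
Proof.
move=> /(Gamma_affineP hA)[d [b [gE _ _ _ _]]] u.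
rewrite (_ : g = (fun u => u *m diag_mx d) + cst b); last exact/funext.
apply: continuousD; last exact: cst_continuous.
exact: (@mulmx_continuous R m m (diag_mx d) u).
Qed.

(** By [pr_gap] the continuous distance between [f] and [g \o h] takes no value strictly between 0
    and 1/2. Starting from 0 it cannot reach 1/2 without passing through 1/4. *)
Lemma path_lift_unique (f h : R -> V) (g : V -> V) (a b : R) :
  continuous f -> continuous h -> Gamma g ->
  (forall x, x \in `[a, b] -> pr (f x) = pr (h x)) -> f a = g (h a) ->
  forall x, x \in `[a, b] -> f x = g (h x).
Proof.
move=> cf ch Gg fh fha x /[dup] xab; rewrite in_itv/= => /andP[ax xb].
pose n y := `|f y - g (h y)|.
have cn : continuous n.
  move=> y; apply: (@continuous_comp _ _ _ (fun y => f y - g (h y)) (fun v => `|v|)).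
    apply: continuousB; first exact: cf.
    by apply: (@continuous_comp _ _ _ h g); [exact: ch|exact: Gamma_continuous].
  exact: norm_continuous.
have [lt|ge] := ltP (n x) 2^-1; first exact: (pr_gap hA Gg (fh x xab)).
have na : n a = 0 by rewrite /n fha subrr normr0.
have [||c cax nc] := @IVT R n a x 4^-1 ax.
- by apply: continuous_subspaceT.
- by rewrite na; apply/andP; split; rewrite ?ge_min ?le_max; apply/orP; [left|right]; lra.
have cab : c \in `[a, b].
  by move: cax; rewrite !in_itv/= => /andP[-> cx]; exact: le_trans cx xb.
suff : n c = 0 by rewrite nc => /eqP; rewrite invr_eq0 pnatr_eq0.
rewrite /n (pr_gap hA Gg (fh c cab)) ?subrr ?normr0// -/(n c) nc.
by rewrite ltf_pV2 ?posrE// ltr_nat.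
Qed.

(** [F] is continuous on the whole plane although it lifts [Y] on the rectangle only; this keeps
    subspace topologies out of the gluing. *)
Definition rectangle_lift (Y : R -> R -> M) (a b c d : R) :=
  exists2 F : R * R -> V, continuous F &
    forall t s : R, t \in `[a, b] -> s \in `[c, d] -> pr (F (t, s)) = Y t s.

Lemma rectangle_lift_swap Y a b c d :
  rectangle_lift Y a b c d -> rectangle_lift (fun s t => Y t s) c d a b.
Proof.
move=> [F cF FY]; exists (fun z => F (z.2, z.1)) => [z|t s tcd sab]; last exact: FY.
apply: (@continuous_comp _ _ _ (fun z : R * R => (z.2, z.1)) F); last exact: cF.
by apply: continuous_pair; [exact: continuous_snd|exact: continuous_fst].
Qed.

(** On the common edge both lifts cover the same path, so a single [g] matches them along all of
    it. *)
Lemma rectangle_lift_glue Y a b c d e : a <= b -> c <= d -> d <= e ->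
  rectangle_lift Y a b c d -> rectangle_lift Y a b d e -> rectangle_lift Y a b c e.
Proof.
move=> ab cd de [F cF FY] [F' cF' FY'].
have dcd : d \in `[c, d] by rewrite in_itv/= cd lexx.
have dde : d \in `[d, e] by rewrite in_itv/= de lexx.
have aab : a \in `[a, b] by rewrite in_itv/= ab lexx.
have prd t : t \in `[a, b] -> pr (F (t, d)) = pr (F' (t, d)).
  by move=> tab; rewrite FY// FY'.
have [g Gg Fg] := (pr_eqP _ _ _).1 (esym (prd a aab)).
have cslice (G : R * R -> V) : continuous G -> continuous (fun t => G (t, d)).
  by move=> cG t; apply: (continuous_slicel (cG _)).
have FgF' := path_lift_unique (cslice F cF) (cslice F' cF') Gg prd Fg.
(* This formula glues [F] and [g F'], which agree on the common edge, without a
   case distinction, so continuity on the whole plane is immediate. *)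
exists (fun z => F (z.1, Num.min z.2 d) + (g (F' (z.1, Num.max z.2 d)) - F (z.1, d))).
  move=> z.
  have c1 (k : R -> R) : continuous k -> {for z, continuous (fun z : R * R => (z.1, k z.2))}.
    move=> ck; apply: continuous_pair; first exact: continuous_fst.
    by apply: (@continuous_comp _ _ _ snd k); [exact: continuous_snd|exact: ck].
  have cmin : continuous (fun s : R => Num.min s d).
    by move=> s; apply: (@continuous_min R R id (cst d)); [exact: cvg_id|exact: cst_continuous].
  have cmax : continuous (fun s : R => Num.max s d).
    by move=> s; apply: (@continuous_max R R id (cst d)); [exact: cvg_id|exact: cst_continuous].
  apply: (@continuousD R V (R * R)%type (fun z => F (z.1, Num.min z.2 d))
    (fun z => g (F' (z.1, Num.max z.2 d)) - F (z.1, d))).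
    exact: (continuous_comp (c1 _ cmin) (cF _)).
  apply: continuousB; last exact: (continuous_comp (c1 _ (@cst_continuous _ _ d)) (cF _)).
  apply: (@continuous_comp _ _ _ _ g); last exact: Gamma_continuous.
  exact: (continuous_comp (c1 _ cmax) (cF' _)).
move=> t s tab; rewrite in_itv/= => /andP[cs se].
case: (leP s d) => [sd|/ltW ds].
  by rewrite -FgF'// subrr addr0 FY// in_itv/= cs.
by rewrite addrCA subrr addr0 pr_Gamma// FY'// in_itv/= ds.
Qed.

(** Rectangles are glued in [s] to a thin strip around each time, then the strips are glued in [t].
    Local lifts are requested only for times inside [[a, b]], since an isotopy lift says nothing
    about other times. *)
Lemma rectangle_lift_exists (Y : R -> R -> M) (a b c d : R) : a <= b -> c <= d ->
  (forall t s : R, t \in `[a, b] -> s \in `[c, d] -> exists2 e, 0 < e &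
     forall a' b' c' d' : R, a' <= b' -> c' <= d' -> t - e < a' -> b' < t + e ->
     s - e < c' -> d' < s + e -> a <= a' -> b' <= b -> rectangle_lift Y a' b' c' d') ->
  rectangle_lift Y a b c d.
Proof.
move=> ab cd loc.
(* The width [e] stays existential because it shrinks with every gluing in [s]. *)
pose strip t c' d' := exists2 e, 0 < e & forall a' b' : R, a' <= b' ->
  t - e < a' -> b' < t + e -> a <= a' -> b' <= b -> rectangle_lift Y a' b' c' d'.
have strips t : t \in `[a, b] -> strip t c d.
  move=> tab; apply: (@interval_cover_ind R (strip t)) => // [s scd|c' d' e' _ cd' de' _].
    have [e e0 He] := loc t s tab scd; exists e => // c' d' _ cd' _ sc' sd'.
    by exists e => // a' b' ab' ta' tb' aa' bb'; exact: He.
  move=> [e1 e10 H1] [e2 e20 H2]; exists (Num.min e1 e2); first by rewrite lt_min e10.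
  move=> a' b' ab' ta' tb' aa' bb'.
  have m1 : Num.min e1 e2 <= e1 by rewrite ge_min lexx.
  have m2 : Num.min e1 e2 <= e2 by rewrite ge_min lexx orbT.
  apply: (rectangle_lift_glue ab' cd' de').
    by apply: H1 => //; [apply: le_lt_trans ta'|apply: lt_le_trans tb' _];
      rewrite ?lerD2l ?lerN2.
  by apply: H2 => //; [apply: le_lt_trans ta'|apply: lt_le_trans tb' _];
    rewrite ?lerD2l ?lerN2.
apply: (@interval_cover_ind R (fun a' b' => rectangle_lift Y a' b' c d)) => //.
  move=> t tab; have [e e0 He] := strips t tab; exists e => // a' b' aa' ab' bb' ta' tb'.
  exact: He.
move=> a' b' e' _ ab' be' _ L1 L2.
apply: (@rectangle_lift_swap (fun s t => Y t s)).
by apply: (@rectangle_lift_glue _ c d a' b' e') => //; apply: rectangle_lift_swap.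
Qed.

Lemma isotopy_rectangle_lift (phi : R -> M -> M) (w : V) (c d : R) : c <= d ->
  (forall t u, t \in `[0, 1] -> exists U h, U (t, u) /\ isotopy_lift phi U h) ->
  rectangle_lift (fun t s => phi t (pr (s *: w))) 0 1 c d.
Proof.
move=> cd loc; apply: rectangle_lift_exists => // t s t01 _.
have [U [h [Uts [oU sh hphi]]]] := loc t (s *: w) t01.
have ck (z : R * R) : {for z, continuous (fun z : R * R => (z.1, z.2 *: w))}.
  apply: continuous_pair; first exact: continuous_fst.
  by apply: continuousZl; exact: continuous_snd.
have : nbhs (t, s) ((fun z : R * R => (z.1, z.2 *: w)) @^-1` U).
  by apply: ck; apply: open_nbhs_nbhs.
move=> /nbhs_ballP[e /= e0 Ue]; exists e => // a' b' c' d' ab' cd' ta' tb' sc' sd' a0 b1.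
(* Clamping keeps the argument in [U], where [h] is continuous, for every point of the plane. *)
exists (fun z => h (clamp a' b' z.1, clamp c' d' z.2 *: w)).
  move=> z; have Uz : U (clamp a' b' z.1, clamp c' d' z.2 *: w).
    apply: (Ue (clamp a' b' z.1, clamp c' d' z.2)); split; rewrite /ball/= ltr_distl.
      by have := @clamp_itv _ _ _ z.1 ab'; rewrite in_itv/=; lra.
    by have := @clamp_itv _ _ _ z.2 cd'; rewrite in_itv/=; lra.
  apply: (@continuous_comp _ _ _ (fun z : R * R => (clamp a' b' z.1, clamp c' d' z.2 *: w)) h).
    apply: continuous_pair.
      apply: (@continuous_comp _ _ _ fst (clamp a' b')); first exact: continuous_fst.
      exact: clamp_continuous.
    apply: continuousZl.
    apply: (@continuous_comp _ _ _ snd (clamp c' d')); first exact: continuous_snd.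
    exact: clamp_continuous.
  exact: (sh 0%N).
move=> x y xab ycd; rewrite /= !clamp_id//; apply: hphi.
  move: xab ycd; rewrite !in_itv/= => xab ycd.
  by apply: (Ue (x, y)); split; rewrite /ball/= ltr_distl; lra.
by move: xab; rewrite !in_itv/=; lra.
Qed.

End Lifting.

(** * The Poincare lemma for 1-forms *)

Section Poincare.
Variables (R : realType) (m : nat).
Local Notation V := 'rV[R]_m.
Notation mu := (@lebesgue_measure R).
Notation "\int01 f" := (\int[mu]_(s in `[0, 1]) f s) (at level 10, f at level 9).
Implicit Types (a : V -> V) (P : V -> R).

Definition pairing_right (v u : V) : R := pairing u v.

Lemma pairing_right_is_linear (v : V) : linear (pairing_right v : V -> R).
Proof. by move=> c x y; rewrite /pairing_right pairingDl pairingZl. Qed.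

HB.instance Definition _ (v : V) :=
  GRing.isLinear.Build R V R _ (pairing_right v) (pairing_right_is_linear v).

Lemma pairing_right_continuous (v : V) : continuous (pairing_right v : V -> R).
Proof.
by move=> u; apply: continuous_pairing; [exact: cvg_id|exact: cst_continuous].
Qed.

Lemma pairing_le (u v : V) : `|pairing u v| <= m%:R * (`|u| * `|v|).
Proof.
rewrite (le_trans (ler_norm_sum _ _ _))//.
rewrite (le_trans (ler_sum _ (G := fun=> `|u| * `|v|) _))//.
  by move=> j _; rewrite normrM ler_pM// row_coord_le.
by rewrite sumr_const card_ord mulr_natl.
Qed.

Lemma derive_coord_sum (W : normedModType R) (f : V -> W) (x v : V) :
  differentiable f x -> 'D_v f x = \sum_j v 0 j *: 'D_'e_j f x.
Proof.
move=> df; rewrite deriveE// [in LHS](row_sum_delta v) linear_sum.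
by apply: eq_bigr => j _; rewrite linearZ deriveE.
Qed.

Lemma closed_derive_sym a : smooth_on setT a ->
  (forall u j k, ('D_'e_j a u) 0 k = ('D_'e_k a u) 0 j) ->
  forall u v w, pairing ('D_v a u) w = pairing ('D_w a u) v.
Proof.
move=> sa ca u v w; have da : differentiable a u by apply: (sa 1%N).1.
have [D DE] : exists D : 'I_m -> V, forall j, 'D_'e_j a u = D j.
  by exists (fun j => 'D_'e_j a u).
have DC j k : D j 0 k = D k 0 j by rewrite -!DE.
have sumD (x y : V) : pairing ('D_x a u) y = \sum_k \sum_j x 0 j * D j 0 k * y 0 k.
  rewrite (derive_coord_sum x da); apply: eq_bigr => k _; rewrite summxE mulr_suml.
  by apply: eq_bigr => j _; rewrite DE mxE.
rewrite !sumD exchange_big/=; apply: eq_bigr => j _; apply: eq_bigr => k _.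
by rewrite DC -mulrA [LHS]mulrC [X in X * _ = _]mulrC.
Qed.

(** The primitive integrates [a] along the segment from the origin. Its derivatives along lines come
    from differentiation under the integral. *)
Lemma poincare a : smooth_on setT a ->
  (forall u j k, ('D_'e_j a u) 0 k = ('D_'e_k a u) 0 j) ->
  exists P, [/\ P 0 = 0, forall u, differentiable P u &
                forall u v, 'D_v P u = pairing (a u) v].
Proof.
move=> sa ca; have sym := closed_derive_sym sa ca.
have da u : differentiable a u by apply: (sa 1%N).1.
have ca0 : continuous a by move=> u; exact: (sa 0%N).
have cDa v : continuous (fun u => 'D_v a u) by move=> u; exact: ((sa 1%N).2 v).
pose P u := \int01 (fun s => pairing (a (s *: u)) u).
(* By closedness the integrand of the derivative of [P] along [v] is the
   [s]-derivative of [s * pairing (a (s *: w)) v]. *)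
have dP u v (t : R) : is_derive t 1 (fun t => P (u + t *: v)) (pairing (a (u + t *: v)) v).
  pose w t : V := u + t *: v.
  pose K (z : R * R) := pairing (a (z.2 *: w z.1)) (w z.1).
  pose K' (z : R * R) := pairing (z.2 *: 'D_v a (z.2 *: w z.1)) (w z.1) +
    pairing (a (z.2 *: w z.1)) v.
  have cw : continuous w.
    move=> x; apply: (@continuousD R V R (cst u) (fun x => x *: v)).
      exact: cst_continuous.
    by apply: continuousZl; exact: cvg_id.
  have cw1 (z : R * R) : {for z, continuous (fun z : R * R => w z.1)}.
    exact: (continuous_comp (@continuous_fst _ _ z) (cw _)).
  have csw (z : R * R) : {for z, continuous (fun z : R * R => z.2 *: w z.1)}.
    exact: (continuousZ (@continuous_snd _ _ z) (cw1 z)).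
  have ca1 (z : R * R) : {for z, continuous (fun z : R * R => a (z.2 *: w z.1))}.
    exact: (continuous_comp (csw z) (ca0 _)).
  have cK z : {for z, continuous K} := continuous_pairing (ca1 z) (cw1 z).
  have cK' z : {for z, continuous K'}.
    have cD : {for z, continuous (fun z : R * R => 'D_v a (z.2 *: w z.1))} :=
      continuous_comp (csw z) (cDa v _).
    have c1 : {for z, continuous (fun z : R * R => z.2 *: 'D_v a (z.2 *: w z.1))} :=
      continuousZ (@continuous_snd _ _ z) cD.
    have cv : {for z, continuous (fun=> v)} by exact: cst_continuous.
    exact: (continuousD (continuous_pairing c1 (cw1 z)) (continuous_pairing (ca1 z) cv)).
  have dw (x : R) : is_derive x 1 w v := is_derive_parametrized_line u v x.
  have das (s : R) : is_derive s 1 (fun s => a (s *: w t)) ('D_(w t) a (s *: w t)).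
    have := is_derive_line (da (0 + s *: w t)); rewrite add0r.
    by rewrite (_ : (fun s => a (0 + s *: w t)) = fun s => a (s *: w t))//;
      apply/funext => x; rewrite add0r.
  have -> : pairing (a (w t)) v = \int01 (fun s => K' (t, s)).
    have -> : pairing (a (w t)) v = 1 * pairing (a (1 *: w t)) v - 0 * pairing (a (0 *: w t)) v.
      by rewrite mul0r subr0 mul1r scale1r.
    apply/esym; apply: (@FTC01 _ _ (fun s => s * pairing (a (s *: w t)) v)) => s _.
    - exact: (continuous_slice (cK' (t, s))).
    - have dp := is_derive_pairing (das s) (is_derive_cst v s 1).
      apply: (is_derive_eq (is_deriveM (is_derive_id s 1) dp)).
      rewrite /K' /= pairingZl (sym (s *: w t) v (w t)).
      rewrite [pairing (a (s *: w t)) 0]pairingC pairing0l.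
      by rewrite addr0 /GRing.scale/= mulr1.
    - apply: (@continuousM R R (fun s => s)); first exact: cvg_id.
      apply: continuous_pairing; last exact: cst_continuous.
      exact: (continuous_slice (ca1 (t, s))).
  apply: (@derive_param _ K K' (t - 1) (t + 1)).
    by rewrite in_itv/=; lra.
  move=> x s _ _; split.
  - exact: continuous_slice.
  - have dsw : is_derive x 1 (fun x => s *: w x) (s *: v) := is_deriveZ s (dw x).
    have dal := differentiable_along (da (s *: w x)) dsw.
    have -> : K' (x, s) = pairing ('D_(s *: v) a (s *: w x)) (w x) + pairing (a (s *: w x)) v.
      by rewrite /K' /= !deriveE// linearZ.
    exact: is_derive_pairing.
  - exact: cK'.
(* Directional derivatives alone do not give differentiability; the mean value form of the increment
   and continuity of [a] do. *)
have MVTP u h : exists2 c : R, c \in `[0, 1] & P (u + h) - P u = pairing (a (u + c *: h)) h.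
  have [c c01] := @MVT_is_derive R (fun t => P (u + t *: h))
    (fun t => pairing (a (u + t *: h)) h) 1 ler01 (fun t _ => dP u h t).
  by rewrite scale1r scale0r addr0 mulr1 => cE; exists c.
have diffP u : differentiable P u.
  apply: (@estimate_differentiable _ _ _ P u (pairing_right (a u)) _ _).1.
    exact: pairing_right_continuous.
  move=> e e0.
  (* [pairing_le] costs a factor [m]; the [+ 1] keeps the denominator positive for [m = 0]. *)
  pose e' := e / (m%:R + 1).
  have m0 : 0 < m%:R + 1 :> R by rewrite ltr_wpDl.
  have e'0 : 0 < e' by rewrite divr_gt0.
  have /cvgrPdist_le/(_ e' e'0)/nbhs_normP[r /= r0 ar] := ca0 u.
  have nr : \forall h \near (0 : V), `|h| < r by apply/nbhs_norm0P; exists r.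
  near=> h.
  have hr : `|h| < r by near: h; exact: nr.
  have [c c01 Pc] := MVTP u h.
  have -> : P (h + u) - P u - pairing_right (a u) h = pairing h (a (u + c *: h) - a u).
    by rewrite [h + u]addrC Pc pairingBr pairingC.
  have auh : `|a (u + c *: h) - a u| <= e'.
    rewrite distrC; apply: ar => /=; rewrite opprD addNKr normrN normrZ.
    move: c01; rewrite in_itv/= => /andP[c0 c1].
    by rewrite ger0_norm// (le_lt_trans _ hr)// ler_piMl.
  rewrite (le_trans (pairing_le _ _))//.
  apply: (@le_trans _ _ ((m%:R + 1) * (`|h| * e'))).
    by rewrite ler_pM ?mulr_ge0// ?lerDl// ler_wpM2l.
  by rewrite [`|h| * _]mulrC mulrA /e' [_ * (e / _)]mulrC divfK// gt_eqF.
exists P; split=> [|u|u v].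
- rewrite /P; under eq_Rintegral do rewrite pairingC pairing0l.
  by rewrite Rintegral_cst// mul0r.
- exact: diffP.
- have := dP u v 0; rewrite scale0r addr0 => -[_ <-].
  have := is_derive_line (diffP (u + 0 *: v)) => -[_].
  by rewrite scale0r addr0.
Unshelve. all: by end_near. Qed.
End Poincare.

(** * Periods of closed 1-forms *)

Section Periods.
Variables (R : realType) (m : nat) (A : 'M[bool]_m).
Hypothesis hA : bott_matrix A.
Local Notation V := 'rV[R]_m.
Local Notation M := (bott_manifold R A).
Local Notation Gamma := (@Gamma R m A).
Local Notation pr := (@pr R m A).
Local Notation form := (closed_form R A).
Implicit Types (a b : form) (P Q : V -> R) (g : V -> V).

Lemma closed_formP a : [/\ smooth_on setT a,
  (forall g, Gamma g -> forall u v, pairing (a (g u)) ('D_v g u) = pairing (a u) v) &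
  (forall u j k, ('D_'e_j a u) 0 k = ('D_'e_k a u) 0 j)].
Proof. by case: a => a /= /asboolP. Qed.

Definition is_primitive a P := [/\ P 0 = 0, forall u, differentiable P u &
  forall u v, 'D_v P u = pairing (a u) v].

Lemma primitive_exists a : exists P, is_primitive a P.
Proof. by have [sa _ ca] := closed_formP a; exact: poincare. Qed.

Lemma is_primitive_unique a P Q : is_primitive a P -> is_primitive a Q -> P = Q.
Proof.
move=> [P0 dP DP] [Q0 dQ DQ]; apply/funext => u; apply/eqP.
rewrite -subr_eq0 -[_ - _]/((P - Q) u); apply/eqP.
rewrite (@zero_gradient _ _ (P - Q) _ _ u 0) ?fctE ?P0 ?Q0 ?subrr// => [x|x v].
  exact: differentiableB.
by rewrite deriveB; [rewrite DP DQ subrr|exact: diff_derivable|exact: diff_derivable].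
Qed.

Definition primitive a : V -> R := projT1 (cid (primitive_exists a)).

Lemma primitiveP a : is_primitive a (primitive a).
Proof. exact: (projT2 (cid (primitive_exists a))). Qed.

Lemma primitive_linear (c : R) a b :
  primitive (c *: a + b) = c *: primitive a + primitive b.
Proof.
apply: is_primitive_unique (primitiveP _) _.
have [P0 dP DP] := primitiveP a; have [Q0 dQ DQ] := primitiveP b.
split=> [|u|u v]; first by rewrite !fctE P0 Q0 scaler0 addr0.
  by apply: differentiableD => //; exact: differentiableZ.
have dPv := derivableP (@diff_derivable _ _ _ _ u v (dP u)).
have dQv := derivableP (@diff_derivable _ _ _ _ u v (dQ u)).
have [_ ->] := is_deriveD (is_deriveZ c dPv) dQv.
by rewrite DP DQ -[RHS]/(pairing (c *: a u + b u) v) pairingDl pairingZl.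
Qed.

Lemma Gamma_derive g : Gamma g -> exists d : V,
  [/\ forall u, differentiable g u, forall u v, 'D_v g u = v *m diag_mx d,
      forall j, d 0 j ^+ 2 = 1,
      forall j k, col j A = col k A -> d 0 j = d 0 k &
      forall j, (forall i, ~~ A i j) -> d 0 j = 1].
Proof.
move=> /(Gamma_affineP hA)[d [b [gE d2 dcol d1 _]]]; exists d.
have cD : continuous (mulmxr (diag_mx d) : V -> V) by exact: mulmx_continuous.
have gE' : g = fun u => mulmxr (diag_mx d) (id u) + b by apply/funext.
have did (u : V) : differentiable (id : V -> V) u by exact: ex_diff.
have dg (u v : V) := derive_affine b v cD (did u).
split=> // [u|u v].
  by rewrite gE'; have [] := dg u 0.
by rewrite gE'; have [_ ->] := dg u v; rewrite derive_id.
Qed.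

(** Invariance of [a] makes the gradient of [primitive a \o g - primitive a] vanish. The constant is
    the period of [a] along the loop defined by [g]. *)
Lemma primitive_Gamma a g : Gamma g -> forall u v,
  primitive a (g u) - primitive a u = primitive a (g v) - primitive a v.
Proof.
move=> Gg u v; have [P0 dP DP] := primitiveP a; have [sa ia ca] := closed_formP a.
have [d [dg Dg _ _ _]] := Gamma_derive Gg.
have dPg x : differentiable (primitive a \o g) x by apply: differentiable_comp.
rewrite -[LHS]/((primitive a \o g - primitive a) u) -[RHS]/((primitive a \o g - primitive a) v).
apply: zero_gradient => [x|x w]; first exact: differentiableB.
rewrite deriveB; [|exact: diff_derivable|exact: diff_derivable].
rewrite DP -(ia g Gg x w) deriveE// diff_comp//= -deriveE// -deriveE// DP.
by rewrite subrr.
Qed.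

Definition form_period (j : 'I_m) a : R := primitive a 'e_j.

Lemma form_period_translate j a u :
  primitive a (u + 'e_j) = primitive a u + form_period j a.
Proof.
have [P0 _ _] := primitiveP a.
have /= := primitive_Gamma a (Gamma_translation_delta R A j) u 0.
by rewrite add0r P0 subr0 => E; rewrite /form_period -E subrKC.
Qed.

(* If [A k j] then [s_ A k] conjugates the translation by ['e_j] to its inverse. *)
Lemma form_period_eq0 j a : (exists k, A k j) -> form_period j a = 0.
Proof.
move=> [k Akj].
have kj : (k < j)%N by rewrite ltnNge; apply/negP => /hA; rewrite Akj.
have sk (u : V) : s_ A k (u + 'e_j) + 'e_j = s_ A k u.
  apply/rowP => i; rewrite !mxE eqxx /=; have [->|ij] := eqVneq i j.
    have jk : (j == k) = false by rewrite -val_eqE gtn_eqF.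
    by rewrite ltnNge ltnW//= jk Akj expr1 mulr1n; ring.
  by rewrite !addr0.
have sk0 := sk 0; rewrite add0r in sk0.
have := form_period_translate j a (s_ A k 'e_j); rewrite sk0.
have := primitive_Gamma a (Gamma_gen R A k) 'e_j 0.
rewrite -/(form_period j a); have [-> _ _] := primitiveP a.
by move=> E1 E2; move: E1; rewrite E2; lra.
Qed.

Lemma exact_form_period a j : a \in @exact_form_pred R m A -> form_period j a = 0.
Proof.
move=> /asboolP[f sf af]; have [P0 dP DP] := primitiveP a.
have fP : primitive a = fun u => f (pr u) - f (pr 0).
  apply: is_primitive_unique (primitiveP a) _; split=> [|u|u v]; first by rewrite subrr.
    by apply: differentiableB; [apply: (sf 1%N).1|exact: differentiable_cst].
  have df : differentiable (fun u : V => f (pr u)) u by apply: (sf 1%N).1.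
  rewrite deriveB; [|exact: diff_derivable|exact: derivable_cst].
  rewrite derive_cst subr0 derive_coord_sum// /pairing; apply: eq_bigr => k _.
  by rewrite -af mulrC.
rewrite /form_period fP -[in X in X - _](add0r 'e_j).
by rewrite (pr_Gamma _ (Gamma_translation_delta R A j)) subrr.
Qed.

(** The primitive itself descends to M(A). Testing the translations by ['e_i] suffices: [s_ A i]
    shifts the primitive by a constant, and twice that constant is the period along ['e_i]. *)
Lemma exact_form_of_periods a : (forall j, form_period j a = 0) ->
  a \in @exact_form_pred R m A.
Proof.
move=> per0; have [P0 dP DP] := primitiveP a; have [sa ia ca] := closed_formP a.
have invP g : Gamma g -> forall u, primitive a (g u) = primitive a u.
  elim=> [i u||f f' _ IHf _ IHf' u|f f' _ IHf _ f'K u] //; last 2 first.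
  - by rewrite /= IHf IHf'.
  - by rewrite -{2}[u]f'K IHf.
  have := primitive_Gamma a (Gamma_gen R A i) u (s_ A i u).
  by rewrite s_comp_s form_period_translate per0 addr0; lra.
apply/asboolP; exists (fun x => primitive a (repr x)).
  have -> : (fun u : V => primitive a (repr (pr u))) = primitive a.
    apply/funext => u; have /pr_eqP[g Gg {2}->] : pr (repr (pr u)) = pr u by rewrite /pr reprK.
    by rewrite invP.
  case=> [|k] /=; first by move=> u _; exact: differentiable_continuous.
  split=> // v; rewrite (_ : (fun u => 'D_v (primitive a) u) = fun u => pairing_right v (a u) + 0).
    by apply: Ck_on_affine; [exact: openT|exact: pairing_right_continuous|exact: sa].
  by apply/funext => u; rewrite DP addr0.
move=> u j; have -> : (fun u : V => primitive a (repr (pr u))) = primitive a.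
  apply/funext => x; have /pr_eqP[g Gg {2}->] : pr (repr (pr x)) = pr x by rewrite /pr reprK.
  by rewrite invP.
by rewrite DP pairing_delta.
Qed.

End Periods.

(** * Periods as coordinates on H^1(M(A)) *)

Section FirstCohomology.
Variables (R : realType) (m : nat) (A : 'M[bool]_m).
Local Notation V := 'rV[R]_m.
Local Notation Gamma := (@Gamma R m A).
Local Notation form := (closed_form R A).
Implicit Types (a b : form) (u v : V).

Definition period (j : 'I_m) (x : H1 A) : R := form_period j (projT1 (cid (lclassP x))).

Lemma form_periodD (c : R) a b j :
  form_period j (c *: a + b) = c * form_period j a + form_period j b.
Proof. by rewrite /form_period primitive_linear. Qed.

Lemma period_coh_class j a : period j (coh_class a) = form_period j a.
Proof.
rewrite /period; case: cid => b /= /lclass_eq/(exact_form_period j).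
rewrite -scaleN1r addrC form_periodD mulN1r => /eqP.
by rewrite addrC subr_eq0 => /eqP.
Qed.

Lemma period_is_linear j : linear_for *%R (period j).
Proof.
move=> c x y; have [a ->] := lclassP x; have [b ->] := lclassP y.
have -> : c *: lclass (exact_form_submod R A) a + lclass (exact_form_submod R A) b =
    coh_class (c *: a + b) by rewrite /coh_class lclassD lclassZ.
by rewrite -!/(coh_class _) !period_coh_class form_periodD.
Qed.

HB.instance Definition _ (j : 'I_m) :=
  GRing.isLinear.Build R (H1 A) R *%R (period j) (period_is_linear j).

Definition zero_column (j : 'I_m) := [forall i, ~~ A i j].

Lemma zero_columnP j : reflect (forall i, ~~ A i j) (zero_column j).
Proof. exact: forallP. Qed.

(** The projection onto R^J; membership of [b] in R^J is expressed below as invariance of [b] under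
    it. *)
Definition zero_column_part (v : V) : V := \row_j if zero_column j then v 0 j else 0.

Hypothesis hA : bott_matrix A.

Lemma period_eq (x y : H1 A) : (forall j, zero_column j -> period j x = period j y) -> x = y.
Proof.
have [a ->] := lclassP x; have [b ->] := lclassP y => ab; apply/lclass_eq.
apply: (exact_form_of_periods hA) => j; have [/ab|] := boolP (zero_column j).
  rewrite !period_coh_class => abj.
  by rewrite -scaleN1r addrC form_periodD mulN1r addrC abj subrr.
move=> /forallPn[i]; rewrite negbK => Aij; apply: (form_period_eq0 hA).
by exists i.
Qed.

Lemma constant_form_closed v : cst (zero_column_part v) \in closed_form_pred A.
Proof.
apply/asboolP; split=> [k|g Gg u w|u j k].
- exact: Ck_on_cst.
- have [d [_ -> _ _ d1]] := Gamma_derive hA Gg.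
  apply: eq_bigr => j _; rewrite mul_mx_diag !mxE.
  by case: (zero_columnP j) => [/d1->|_]; rewrite ?mulr1// !mul0r.
- by rewrite !derive_cst !mxE.
Qed.

Definition constant_form v : form := ClosedForm (constant_form_closed v).

Lemma form_period_constant v j :
  form_period j (constant_form v) = zero_column_part v 0 j.
Proof.
rewrite /form_period (is_primitive_unique (primitiveP _) (Q := pairing_right (zero_column_part v))).
  by rewrite /pairing_right pairingC pairing_delta.
split=> [|u|u w]; first by rewrite /pairing_right pairing0l.
  by apply: linear_differentiable; exact: pairing_right_continuous.
rewrite deriveE; last by apply: linear_differentiable; exact: pairing_right_continuous.
by rewrite diff_lin; [rewrite /pairing_right pairingC|exact: pairing_right_continuous].
Qed.

Lemma period_constant v j : zero_column j -> period j (coh_class (constant_form v)) = v 0 j.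
Proof. by rewrite period_coh_class form_period_constant mxE => ->. Qed.

End FirstCohomology.

(** * Translation loops *)

Section BottFormMatrix.
Variables (R : realType) (m : nat) (A : 'M[bool]_m) (c : 'I_m -> 'I_m -> R).
Local Notation V := 'rV[R]_m.
Local Notation zcp := (@zero_column_part R m A).
Implicit Types (u v w : V).

Definition bott_form_upper : 'M[R]_m :=
  \matrix_(j, k) if (j < k)%N && (col j A == col k A) then c j k else 0.

Definition bott_form_mx : 'M[R]_m := bott_form_upper - bott_form_upper^T.

Local Notation Om := bott_form_mx.

Lemma bott_formE u v w : bott_form A c u v w = pairing (v *m Om) w.
Proof.
have sumE (N : 'M[R]_m) : pairing (v *m N) w = \sum_j \sum_k v 0 j * N j k * w 0 k.
  rewrite exchange_big; apply: eq_bigr => k _; rewrite mxE mulr_suml.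
  by apply: eq_bigr.
rewrite mulmxBr -scaleN1r pairingDl pairingZl mulN1r !sumE [X in _ - X]exchange_big -sumrB.
apply: eq_bigr => j _; rewrite -sumrB [LHS]big_mkcond; apply: eq_bigr => k _.
by rewrite !mxE; case: ifP => _; ring.
Qed.

Lemma bott_form_mx_skew : Om^T = - Om.
Proof. by rewrite /bott_form_mx linearB/= trmxK opprB. Qed.

Lemma bott_form_mx_eq0 j k : col j A <> col k A -> Om j k = 0.
Proof.
move=> /eqP jk; rewrite !mxE (negPf jk) andbF.
by rewrite [col k A == _]eq_sym (negPf jk) andbF subrr.
Qed.

Lemma bott_form_mx_unit : nondegenerate_form (bott_form A c) -> Om \in unitmx.
Proof.
move=> nd; rewrite -row_free_unit; apply/inj_row_free => v vOm.
by apply: (nd 0) => w; rewrite bott_formE vOm pairing0l.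
Qed.

Lemma zero_column_col j k : col j A = col k A -> zero_column A j = zero_column A k.
Proof.
move=> jk; apply: eq_forallb => i.
by have /colP/(_ i) := jk; rewrite !mxE => ->.
Qed.

(** [Om] is block diagonal for the classes of equal columns, and J is empty or one such class. *)
Lemma zero_column_part_mulmx v : zcp v *m Om = zcp (v *m Om).
Proof.
apply/rowP => k; rewrite [RHS]mxE [LHS]mxE mxE.
case: ifP => zk; last first.
  rewrite big1// => j _; rewrite mxE; case: ifP => zj; last by rewrite mul0r.
  by rewrite bott_form_mx_eq0 ?mulr0// => /zero_column_col; rewrite zk zj.
apply: eq_bigr => j _; rewrite mxE; case: ifP => // zj.
by rewrite bott_form_mx_eq0 ?mulr0 ?mul0r// => /zero_column_col; rewrite zk zj.
Qed.

(** Conjugation multiplies the entry [Om j k] by [d_j d_k], which is 1 when the columns agree;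
    otherwise the entry is 0. *)
Lemma diag_preserves_bott_form (d : V) : (forall j, d 0 j ^+ 2 = 1) ->
  (forall j k, col j A = col k A -> d 0 j = d 0 k) ->
  forall v w, pairing (v *m diag_mx d *m Om) (w *m diag_mx d) = pairing (v *m Om) w.
Proof.
move=> d2 dcol v w.
have DOm : diag_mx d *m Om *m diag_mx d = Om.
  apply/matrixP => j k; rewrite mul_mx_diag mul_diag_mx mxE [X in X * _]mxE.
  have [jk|jk] := eqVneq (col j A) (col k A).
    by rewrite mulrAC (dcol j k jk) -expr2 d2 mul1r.
  by rewrite bott_form_mx_eq0 ?mulr0 ?mul0r//; apply/eqP.
by rewrite !pairing_mx trmx_mul tr_diag_mx -!mulmxA [diag_mx d *m (Om *m _)]mulmxA
  [diag_mx d *m Om *m _]mulmxA DOm !mulmxA.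
Qed.

Lemma zero_column_part_linear (a : R) u v : zcp (a *: u + v) = a *: zcp u + zcp v.
Proof. by apply/rowP => j; rewrite !mxE; case: ifP => _; rewrite ?mulr0 ?addr0. Qed.

Lemma zero_column_part_diag (b d : V) : zcp b = b ->
  (forall j, (forall i, ~~ A i j) -> d 0 j = 1) -> b *m diag_mx d = b.
Proof.
move=> bz d1; apply/rowP => j; rewrite -bz mul_mx_diag !mxE.
by case: (zero_columnP A j) => [/d1->|_]; rewrite ?mulr1// mul0r.
Qed.

End BottFormMatrix.

(* At the end points t = 0 and t = 1 a local lift is only constrained on one
   side. *)
Lemma one_sided_derive (R : realType) (W : normedModType R) (k : R -> W) (t : R) (b D : W) :
  t \in `[0, 1] -> is_derive (0 : R) 1 k D ->
  (\forall x \near (0 : R), t + x \in `[0, 1] -> k x = k 0 + x *: b) -> D = b.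
Proof.
rewrite in_itv/= => /andP[t0 t1] [dk DE] kb.
have /derivable1_diffP dk0 := dk.
apply/eqP; rewrite -subr_eq0 -normr_le0; apply/ler_addgt0Pl => e e0; rewrite addr0.
have kbe := @filterI _ _ (nbhs_filter (0 : R)) _ _ kb (differentiable_estimate dk0 e0).
have [r /= r0 Hr] := (nbhs_normP _ _).1 kbe.
pose y := Num.min r 1 / 2.
have y0 : 0 < y by rewrite divr_gt0// lt_min r0 ltr01.
have yr : y < r.
  by rewrite /y ltr_pdivrMr// (@le_lt_trans _ _ r) ?ge_min ?lexx// ltr_pMr// ltr1n.
have y1 : y <= 2^-1 by rewrite /y ler_pdivrMr// mulVf// ge_min lexx orbT.
(* The increment points into [0, 1]; since [y] is at most 1/2, moving away from the nearer end point
   never leaves the interval. *)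
pose x := if t <= 2^-1 then y else - y.
have xy : `|x| = y by rewrite /x; case: ifP => _; rewrite ?normrN gtr0_norm.
have xt : t + x \in `[0, 1].
  by rewrite in_itv/= /x; case: (leP t 2^-1) => ?; lra.
have [|/(_ xt) kx /=] := Hr x; first by rewrite /= sub0r normrN xy.
have dkx : 'd k 0 x = x *: D.
  by rewrite -[in LHS](mulr1 x) -[x * 1]/(x *: (1 : R)) linearZ -DE deriveE.
rewrite addr0 kx dkx [k 0 + _]addrC addrK -scalerBr normrZ xy mulrC ler_pM2r//.
by rewrite distrC.
Qed.

Section TranslationLoops.
Variables (R : realType) (m : nat) (A : 'M[bool]_m).
Hypothesis hA : bott_matrix A.
Variable c : 'I_m -> 'I_m -> R.
Local Notation V := 'rV[R]_m.
Local Notation M := (bott_manifold R A).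
Local Notation Gamma := (@Gamma R m A).
Local Notation pr := (@pr R m A).
Local Notation zcp := (@zero_column_part R m A).
Local Notation Om := (bott_form_mx A c).
Local Notation omega := (bott_form A c).

(** For [b] in R^J translation by [b] commutes with Gamma(A), so the choice of representative is
    then immaterial. *)
Definition translation (b : V) (x : M) : M := pr (repr x + b).

(** The global lift of the translation isotopy. It is linear in the pair of time and point, whence
    its smoothness. *)
Definition drift (b : V) (z : R * V) : V := z.2 + z.1 *: b.

Lemma drift_is_linear (b : V) : linear (drift b).
Proof.
move=> a x y; rewrite /drift/= scalerDl scalerDr -!addrA; congr (_ + _).
by rewrite addrCA scalerA.
Qed.

HB.instance Definition _ (b : V) :=
  GRing.isLinear.Build R (R * V)%type V _ (drift b) (drift_is_linear b).

Lemma drift_continuous (b : V) : continuous (drift b).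
Proof.
move=> z; have cs : {for z, continuous (fun z : R * V => z.2)} := @continuous_snd _ _ z.
have cf : {for z, continuous (fun z : R * V => z.1 *: b)}.
  by apply: continuousZl; exact: continuous_fst.
exact: (continuousD cs cf).
Qed.

Lemma drift_smooth (b : V) : smooth_on setT (drift b).
Proof.
move=> k; rewrite (_ : drift b = fun z => drift b (id z) + 0); last first.
  by apply/funext => z; rewrite addr0.
by apply: Ck_on_affine; [exact: openT|exact: drift_continuous|exact: smooth_on_id].
Qed.

Lemma Gamma_drift g (b : V) : Gamma g -> zcp b = b -> forall u, g (u + b) = g u + b.
Proof.
move=> /(Gamma_affineP hA)[d [b' [gE _ _ d1 _]]] bz u.
by rewrite !gE mulmxDl (zero_column_part_diag bz d1) addrAC.
Qed.

Lemma translation_pr (b u : V) : zcp b = b -> translation b (pr u) = pr (u + b).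
Proof.
move=> bz; have /(pr_eqP A _ _).1[g Gg uE] : pr (repr (pr u)) = pr u by rewrite /pr reprK.
by rewrite /translation [in RHS]uE -Gamma_drift// (pr_Gamma _ Gg).
Qed.

Lemma zcpZ (t : R) (b : V) : zcp b = b -> zcp (t *: b) = t *: b.
Proof. by move=> bz; apply/rowP => j; rewrite -[in RHS]bz !mxE; case: ifP; rewrite ?mulr0. Qed.

Lemma translation_smooth (b : V) : zcp b = b -> smooth_map (translation b).
Proof.
move=> bz u; exists setT, (fun u => u + b); split=> //; split; first exact: openT.
  move=> k; have cid' : continuous (idfun : V -> V) by move=> x; exact: cvg_id.
  exact: (@Ck_on_affine R V V V setT k idfun b id openT cid' (@smooth_on_id R V setT k)).
by move=> x _; rewrite translation_pr.
Qed.

Lemma translationD (b b' : V) : zcp b = b -> zcp b' = b' -> forall x,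
  translation b (translation b' x) = translation (b' + b) x.
Proof. by move=> bz bz' x; rewrite {2}/translation translation_pr// /translation addrA. Qed.

Lemma translation0 : translation 0 = id.
Proof. by apply/funext => x; rewrite /translation addr0 /pr reprK. Qed.

Lemma translation_symp (b : V) : zcp b = b -> Symp omega (translation b).
Proof.
move=> bz; have bz' : zcp (- b) = - b by rewrite -scaleN1r zcpZ.
split.
  split; first exact: translation_smooth.
  exists (translation (- b)); split=> [||]; first exact: translation_smooth.
    by move=> x; rewrite translationD// subrr translation0.
  by move=> x; rewrite translationD// addNr translation0.
move=> U h [oU sh prh] u v w Uu.
have prhb x : U x -> pr (h x) = pr (x + b) by move=> Ux; rewrite prh// translation_pr.
(* An arbitrary local lift [h] differs at [u] from the obvious one by some [g]; by continuity and
   [pr_gap] the same [g] works near [u], so the differential of [h] is that of [g]. *)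
have [g Gg hu] := (pr_eqP A _ _).1 (esym (prhb u Uu)).
have [d [dg Dg d2 dcol _]] := Gamma_derive hA Gg.
have hg : \forall x \near u, g (x + b) = h x.
  have ch : {for u, continuous h} by exact: (sh 0%N).
  have cb : {for u, continuous (fun x : V => x + b)}.
    exact: (continuousD (@cvg_id _ (nbhs u)) (@cst_continuous _ _ b u)).
  have cgb : {for u, continuous (fun x : V => g (x + b))}.
    apply: (@continuous_comp _ _ _ (fun x : V => x + b) g); first exact: cb.
    exact: (Gamma_continuous hA Gg).
  have /cvgrPdist_lt/(_ 2^-1) := continuousB ch cgb.
  rewrite !fctE hu subrr invr_gt0 ltr0n => /(_ isT) nH.
  have nU : nbhs u U by exact: open_nbhs_nbhs.
  apply: filterS2 nU nH => x Ux; rewrite sub0r normrN => Hx; apply/esym.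
  by apply: (pr_gap hA Gg (prhb x Ux)).
have Dh x : 'D_x h u = x *m diag_mx d.
  rewrite -(near_eq_derive x hg) -(Dg u x).
  rewrite (_ : (fun y : V => g (y + b)) = g + cst b); last first.
    by apply/funext => y; rewrite Gamma_drift.
  have dgx := derivableP (@diff_derivable _ _ _ _ u x (dg u)).
  by have [_ ->] := is_deriveD dgx (is_derive_cst b u x); rewrite addr0.
by rewrite !bott_formE !Dh diag_preserves_bott_form.
Qed.

Lemma translation_isotopy (b : V) : zcp b = b ->
  symplectic_isotopy omega (fun t : R => translation (t *: b)).
Proof.
move=> bz; split=> [t _|t u _|]; last by rewrite scale0r translation0.
  by apply: translation_symp; exact: zcpZ.
exists setT, (drift b); split=> //; split; [exact: openT|exact: drift_smooth|].
by move=> {}t {}u _ _; rewrite /drift/= translation_pr// zcpZ.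
Qed.

Lemma translation_generated (b : V) : zcp b = b ->
  @generated_by R m A (fun t : R => translation (t *: b)) (fun _ _ => b).
Proof.
move=> bz; split=> [t _|U h [oU sh prh] t u Utu t01].
  split=> [k|g Gg u]; first exact: Ck_on_cst.
  have [d [_ -> _ _ d1]] := Gamma_derive hA Gg.
  by rewrite (zero_column_part_diag bz d1).
have dh : differentiable h (t, u) by apply: (sh 1%N).1.
pose e1 : R * V := (1, 0); pose k (x : R) := h ((t, u) + x *: e1).
have dh0 : differentiable h ((t, u) + 0 *: e1) by rewrite scale0r addr0.
have dk := is_derive_line dh0.
have k0 : k 0 = h (t, u) by rewrite /k scale0r addr0.
have -> : 'D_e1 h (t, u) = 'D_e1 h ((t, u) + 0 *: e1) by rewrite scale0r addr0.
apply: (@one_sided_derive _ _ k t) => //.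
(* Near [t], at times in [0, 1], the given lift must be [g] applied to the straight drift; as [g]
   commutes with translation along [b], it moves with velocity [b]. *)
have [g Gg hg] : exists2 g, Gamma g & h (t, u) = g (u + t *: b).
  by apply/pr_eqP; rewrite prh// translation_pr// zcpZ.
have tE x : (t, u) + x *: e1 = (t + x, u).
  by rewrite /e1; congr (_, _); rewrite /= ?scaler0 ?addr0// /GRing.scale/= mulr1.
have ck : {for (0 : R), continuous k}.
  by apply/differentiable_continuous/derivable1_diffP; have [] := dk.
have cb : {for (0 : R), continuous (fun x : R => k 0 + x *: b)}.
  apply: (@continuousD R V R (cst (k 0)) (fun x => x *: b)).
    exact: cst_continuous.
  by apply: continuousZl; exact: cvg_id.
have /cvgrPdist_lt/(_ 2^-1) := continuousB ck cb.
rewrite !fctE scale0r addr0 subrr invr_gt0 ltr0n => /(_ isT) nH.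
have nU : \forall x \near (0 : R), U (t + x, u).
  have c1 : {for (0 : R), continuous (fun x : R => (t + x, u))}.
    apply: continuous_pair; last exact: cst_continuous.
    exact: (continuousD (@cst_continuous _ _ t 0) (@cvg_id _ (nbhs (0 : R)))).
  by apply: c1; rewrite /= addr0; exact: open_nbhs_nbhs.
apply: filterS2 nU nH => x Ux Hx xt01.
rewrite sub0r normrN in Hx.
have gE : g (u + (t + x) *: b) = k 0 + x *: b.
  by rewrite scalerDl addrA Gamma_drift ?zcpZ// -hg k0.
rewrite -gE; apply: (pr_gap hA Gg); last by rewrite gE.
by rewrite /k tE prh// translation_pr// zcpZ.
Qed.

Lemma translation_flux (b : V) : zcp b = b -> Gamma (fun u => u + b) ->
  flux_group A omega (coh_class (constant_form hA (b *m Om))).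
Proof.
move=> bz Gb; exists (fun t => translation (t *: b)); split.
- exact: translation_isotopy.
- apply/funext => x; rewrite scale1r /translation.
  by rewrite -[RHS](@reprK _ _ x) -/(pr (repr x)) -(pr_Gamma (repr x) Gb).
- exists (fun _ _ => b), (fun=> constant_form hA (b *m Om)); split.
  + exact: translation_generated.
  + move=> t _; apply/funext => u; apply/rowP => j.
    (* The projection built into [constant_form] is harmless here: [b *m Om] already lies in R^J. *)
    by rewrite [RHS]mxE bott_formE pairing_delta /= -zero_column_part_mulmx bz.
  + move=> l; split.
      by apply: integrable01 => s _; exact: cst_continuous.
    exact: Rintegral01_cst.
Qed.

End TranslationLoops.

(** * The lift of a loop of symplectomorphisms *)

Section LiftedIsotopy.
Variables (R : realType) (m : nat) (A : 'M[bool]_m).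
Hypothesis hA : bott_matrix A.
Local Notation V := 'rV[R]_m.
Local Notation M := (bott_manifold R A).
Local Notation Gamma := (@Gamma R m A).
Local Notation pr := (@pr R m A).

(** Lifted lines are normalised at [s = 0], an interior point of their parameter interval. Some [g1]
    matches the paths from the left end on, and freeness of the action identifies it with [g] at
    [x0]. *)
Lemma path_lift_unique_at (f h : R -> V) (g : V -> V) (a b x0 : R) :
  continuous f -> continuous h -> Gamma g ->
  (forall x, x \in `[a, b] -> pr (f x) = pr (h x)) ->
  x0 \in `[a, b] -> f x0 = g (h x0) ->
  forall x, x \in `[a, b] -> f x = g (h x).
Proof.
move=> cf ch Gg fh x0ab fhx0 x xab.
have aab : a \in `[a, b].
  by move: x0ab; rewrite !in_itv/= lexx => /andP[ax xb]; exact: le_trans ax xb.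
have [g1 Gg1 fa] := (pr_eqP A _ _).1 (esym (fh a aab)).
have fE := path_lift_unique hA cf ch Gg1 fh fa.
have -> : g = g1 by apply: (Gamma_free hA (p := h x0) Gg Gg1); rewrite -fhx0; exact: fE.
exact: fE.
Qed.

Variable phi : R -> M -> M.
Hypothesis phi_loc : forall (t : R) (u : V), t \in `[0, 1] ->
  exists U h, U (t, u) /\ isotopy_lift phi U h.
Hypothesis phi0 : phi 0 = id.
Hypothesis phi1 : phi 1 = id.

(* [G] lifts (t, s) |-> phi_t (pr (s w)).  Times outside [0, 1] are clamped, so
   that [G] is defined and continuous on the whole plane; [s] ranges over a
   neighbourhood of [0, 1], so that [s]-derivatives are two-sided there. *)
Definition lifted_line (w : V) (G : R * R -> V) :=
  [/\ continuous G, G (0, 0) = 0, forall t s, G (t, s) = G (clamp 0 1 t, s) &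
      forall t s : R, s \in `[-1, 2] -> pr (G (t, s)) = phi (clamp 0 1 t) (pr (s *: w))].

Lemma clamp01 t : clamp 0 1 t \in `[0, 1 : R].
Proof. exact: clamp_itv. Qed.

Lemma lifted_line_exists w : exists G, lifted_line w G.
Proof.
have [F cF FY] : rectangle_lift (fun t s => phi t (pr (s *: w))) 0 1 (-1) 2.
  by apply: isotopy_rectangle_lift => //; lra.
have i00 : 0 \in `[0, 1 : R] by rewrite in_itv/= lexx ler01.
have i02 : 0 \in `[-1, 2 : R] by rewrite in_itv/=; lra.
have := FY 0 0 i00 i02; rewrite phi0 scale0r => /(pr_eqP A _ _).1[g Gg F0].
exists (fun z => g (F (clamp 0 1 z.1, z.2))); split=> [z||t s|t s s02].
- have c1 : {for z, continuous (fun z : R * R => (clamp 0 1 z.1, z.2))}.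
    apply: continuous_pair; last exact: continuous_snd.
    exact: (continuous_comp (@continuous_fst _ _ z) (@clamp_continuous R 0 1 _)).
  have c2 := continuous_comp c1 (cF _).
  apply: (@continuous_comp _ _ _ _ g); first exact: c2.
  exact: (Gamma_continuous hA Gg).
- by rewrite /= clamp_id.
- by rewrite /= (clamp_id (clamp01 t)).
- by rewrite (pr_Gamma _ Gg) FY// clamp01.
Qed.

Lemma continuous_time (G : R * R -> V) s : continuous G -> continuous (fun t => G (t, s)).
Proof. by move=> cG t; exact: (continuous_slicel (cG (t, s))). Qed.

Lemma continuous_space (G : R * R -> V) t : continuous G -> continuous (fun s => G (t, s)).
Proof. by move=> cG s; exact: (continuous_slice (cG (t, s))). Qed.

Lemma continuous_line (w : V) : continuous (fun s : R => s *: w).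
Proof. by move=> s; apply: continuousZl; exact: cvg_id. Qed.

Lemma lifted_line0 w G (s : R) : lifted_line w G -> s \in `[-1, 2] -> G (0, s) = s *: w.
Proof.
move=> [cG G0 _ Gpr].
have i0 : 0 \in `[-1, 2 : R] by rewrite in_itv/=; lra.
apply: (path_lift_unique_at (f := fun s => G (0, s)) (h := fun s => s *: w)
  (@continuous_space G 0 cG) (@continuous_line w) (Gamma_id R A) _ i0 _).
- by move=> x x02; rewrite Gpr// clamp_id ?phi0// in_itv/= lexx ler01.
- by rewrite scale0r.
Qed.

(** Both time paths lift the orbit of the same point of M(A), and at time 0 they are related by [g].
    This one fact gives periodicity in [s], independence of the direction and centrality of the end
    point. *)
Lemma lifted_line_time w w' G G' (s s' : R) g : lifted_line w G -> lifted_line w' G' ->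
  s \in `[-1, 2] -> s' \in `[-1, 2] -> Gamma g -> s' *: w' = g (s *: w) ->
  forall t, G' (t, s') = g (G (t, s)).
Proof.
move=> LG LG' s02 s02' Gg sw t.
have [cG G0 Gc Gpr] := LG; have [cG' G0' Gc' Gpr'] := LG'.
rewrite Gc Gc'.
have i0 : 0 \in `[0, 1 : R] by rewrite in_itv/= lexx ler01.
apply: (path_lift_unique_at (f := fun t => G' (t, s')) (h := fun t => G (t, s))
  (@continuous_time G' s' cG') (@continuous_time G s cG) Gg _ i0 _ (clamp01 t)).
- by move=> x x01; rewrite Gpr// Gpr'// sw (pr_Gamma _ Gg).
- by rewrite (lifted_line0 LG)// (lifted_line0 LG').
Qed.

Lemma lifted_line1 w G : lifted_line w G ->
  exists2 g, Gamma g & forall s, s \in `[-1, 2] -> G (1, s) = g (s *: w).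
Proof.
move=> [cG G0 _ Gpr].
have i01 : 1 \in `[0, 1 : R] by rewrite in_itv/= lexx ler01.
have prG x : x \in `[-1, 2] -> pr (G (1, x)) = pr (x *: w).
  by move=> x02; rewrite Gpr// clamp_id// phi1.
have i02 : -1 \in `[-1, 2 : R] by rewrite in_itv/=; lra.
have [g Gg gE] := (pr_eqP A _ _).1 (esym (prG _ i02)).
exists g => //.
exact: (path_lift_unique_at (f := fun s => G (1, s)) (h := fun s => s *: w)
  (@continuous_space G 1 cG) (@continuous_line w) Gg prG i02 gE).
Qed.

Lemma s_delta (j : 'I_m) : 2^-1 *: 'e_j = s_ A j 0 :> V.
Proof.
apply/rowP => k; rewrite !mxE eqxx/=.
have [->|kj] := eqVneq k j; first by rewrite ltnn add0r mulr1.
by rewrite !mulr0; case: ifP.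
Qed.

(* The end point of the lifted isotopy is central in Gamma(A), and the central
   elements are the translations along the coordinates with zero column. *)
Lemma commuting_translation g : Gamma g -> (forall j, g (s_ A j 0) = s_ A j (g 0)) ->
  (forall u, g u = u + g 0) /\ zero_column_part A (g 0) = g 0.
Proof.
move=> Gg gs0.
have comm j u : g (s_ A j u) = s_ A j (g u).
  have Gs := Gamma_gen R A j.
  have E := Gamma_free hA (Gamma_comp Gg Gs) (Gamma_comp Gs Gg) (gs0 j).
  by rewrite -[LHS]/((g \o s_ A j) u) E.
have [d [b [gE _ _ _ _]]] := Gamma_affineP hA Gg.
have bE : g 0 = b by rewrite gE mul0mx add0r.
have d1 j : d 0 j = 1.
  have /rowP/(_ j) : g 'e_j = g 0 + 'e_j.
    by rewrite -(s_comp_s A) -!comm s_comp_s add0r.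
  by rewrite gE bE mul_mx_diag !mxE !eqxx mul1r addrC => /addrI.
have gT u : g u = u + g 0.
  rewrite gE bE; congr (_ + _); apply/rowP => j.
  by rewrite mul_mx_diag mxE d1 mulr1.
split=> //; apply/rowP => k; rewrite mxE; case: ifPn => // /forallPn[j].
rewrite negbK => Ajk; have jk : (j < k)%N by rewrite ltnNge; apply/negP => /hA; rewrite Ajk.
have kj : (k == j) = false by rewrite -val_eqE gtn_eqF.
have /rowP/(_ k) := gs0 j; rewrite gT !mxE ltnNge ltnW//= kj Ajk expr1 mulr0 add0r.
by move=> E; lra.
Qed.

Lemma monodromy : exists b : V,
  [/\ Gamma (fun u => u + b), zero_column_part A b = b &
      forall j G s, lifted_line 'e_j G -> s \in `[-1, 2] -> G (1, s) = s *: 'e_j + b].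
Proof.
have i0 : 0 \in `[-1, 2 : R] by rewrite in_itv/=; lra.
have ih : 2^-1 \in `[-1, 2 : R] by rewrite in_itv/=; lra.
(* The line of the zero vector is the lifted orbit of the base point. It is the edge [s = 0] of
   every square, so its end element [g] serves all [j]. *)
have [G0 LG0] := lifted_line_exists 0.
have [g Gg G01] := lifted_line1 LG0.
have Gj j G : lifted_line 'e_j G -> forall s, s \in `[-1, 2] -> G (1, s) = g (s *: 'e_j).
  move=> LG; have [gj Ggj Gj1] := lifted_line1 LG.
  suff -> : g = gj by [].
  apply: (Gamma_free hA (p := 0) Gg Ggj).
  have := lifted_line_time LG0 LG i0 i0 (Gamma_id R A) _ 1.
  by rewrite !scale0r => /(_ erefl); rewrite G01// Gj1// !scale0r.
have gs0 j : g (s_ A j 0) = s_ A j (g 0).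
  have [G LG] := lifted_line_exists 'e_j.
  (* At [s = 1/2] the line of ['e_j] passes through the image of 0 under [s_ A j]; comparing the
     time paths at [s = 0] and [s = 1/2] at time 1 gives commutation. *)
  have := lifted_line_time LG LG i0 ih (Gamma_gen R A j) _ 1.
  by rewrite scale0r s_delta => /(_ erefl); rewrite !(Gj j G LG)// s_delta scale0r.
have [gT zT] := commuting_translation Gg gs0.
exists (g 0); split=> // [|j G s LG s02]; last by rewrite (Gj j G LG).
by rewrite (_ : (fun u => _) = g)//; apply/funext.
Qed.

Lemma isotopy_lift_Gamma U h g : isotopy_lift phi U h -> Gamma g ->
  isotopy_lift phi U (g \o h).
Proof.
move=> [oU sh prh] Gg; split=> // [k|t u Utu t01]; last first.
  by rewrite /= (pr_Gamma _ Gg) prh.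
have [d [b [gE _ _ _ _]]] := Gamma_affineP hA Gg.
have cD : continuous (mulmxr (diag_mx d) : V -> V) by exact: mulmx_continuous.
rewrite (_ : g \o h = fun z => mulmxr (diag_mx d) (h z) + b); last first.
  by apply/funext => z; rewrite /= gE.
exact: Ck_on_affine.
Qed.

Lemma continuous_lift_point (w : V) (t s : R) :
  {for (t, s), continuous (fun z : R * R => (clamp 0 1 z.1, z.2 *: w))}.
Proof.
apply: continuous_pair.
  exact: (continuous_comp (@continuous_fst _ _ (t, s)) (@clamp_continuous R 0 1 _)).
by apply: continuousZl; exact: continuous_snd.
Qed.

(** The glued lift is only known to be continuous; being close to a smooth local lift corrected by
    an element of Gamma(A), it agrees with it nearby. *)
Lemma lifted_line_local w G (t s : R) : lifted_line w G -> s \in `]-1, 2[ ->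
  exists U h, [/\ isotopy_lift phi U h, U (clamp 0 1 t, s *: w) &
    \forall z \near (t, s), U (clamp 0 1 z.1, z.2 *: w) /\
      G z = h (clamp 0 1 z.1, z.2 *: w)].
Proof.
move=> [cG G0 _ Gpr] s02.
have [U [h0 [Uts Lh0]]] := phi_loc (s *: w) (clamp01 t).
have [oU sh0 prh0] := Lh0.
have s02' : s \in `[-1, 2] by move: s02; rewrite !in_itv/= => /andP[/ltW-> /ltW->].
have [g Gg Gts] : exists2 g, Gamma g & G (t, s) = g (h0 (clamp 0 1 t, s *: w)).
  by apply/pr_eqP; rewrite Gpr// prh0// clamp01.
have Lh := isotopy_lift_Gamma Lh0 Gg.
exists U, (g \o h0); split=> //.
have ck := @continuous_lift_point w t s.
have nU : nbhs (t, s) [set z : R * R | U (clamp 0 1 z.1, z.2 *: w)].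
  by apply: ck; exact: open_nbhs_nbhs.
have nS : nbhs (t, s) [set z : R * R | z.2 \in `]-1, 2[].
  exact: (@continuous_snd R R (t, s) _ (near_in_itvoo s02)).
have ch : {for (t, s), continuous (fun z : R * R => g (h0 (clamp 0 1 z.1, z.2 *: w)))}.
  have c0 : {for (clamp 0 1 t, s *: w), continuous h0} by exact: (sh0 0%N).
  apply: (@continuous_comp _ _ _ (fun z : R * R => h0 (clamp 0 1 z.1, z.2 *: w)) g).
    by apply: (@continuous_comp _ _ _ (fun z : R * R => (clamp 0 1 z.1, z.2 *: w)) h0).
  exact: (Gamma_continuous hA Gg).
have /cvgrPdist_lt/(_ 2^-1) := continuousB (cG (t, s)) ch.
rewrite !fctE Gts subrr invr_gt0 ltr0n => /(_ isT) nH.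
apply: filterS3 nU nS nH => -[x y] Uxy y02 Hxy; split=> //.
rewrite sub0r normrN in Hxy.
have y02' : y \in `[-1, 2] by move: y02; rewrite !in_itv/= => /andP[/ltW-> /ltW->].
by apply: (pr_gap hA Gg); rewrite ?Gpr// prh0// clamp01.
Qed.

End LiftedIsotopy.

(** * Derivatives of the lifted square *)

Lemma near_slice_right (T U : topologicalType) (P : set (T * U)) (x : T) (y : U) :
  nbhs (x, y) P -> nbhs y [set s | P (x, s)].
Proof.
move=> nP; have c : {for y, continuous (fun s : U => (x, s))}.
  by apply: continuous_pair; [exact: cst_continuous|exact: cvg_id].
exact: (c P nP).
Qed.

Lemma near_slice_left (T U : topologicalType) (P : set (T * U)) (x : T) (y : U) :
  nbhs (x, y) P -> nbhs x [set t | P (t, y)].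
Proof.
move=> nP; have c : {for x, continuous (fun t : T => (t, y))}.
  by apply: continuous_pair; [exact: cvg_id|exact: cst_continuous].
exact: (c P nP).
Qed.

Lemma near_eq_continuous (T U : topologicalType) (f g : T -> U) (x : T) :
  (\forall y \near x, g y = f y) -> {for x, continuous g} -> {for x, continuous f}.
Proof.
move=> fg cg; rewrite /prop_for /continuous_at -(nbhs_singleton fg).
by apply: cvg_trans cg; exact: near_eq_cvg.
Qed.

Lemma derive_swap_row (R : realType) (m : nat) (W : normedModType R) (U : set W)
    (f : W -> 'rV[R]_m) (x v w : W) : open U -> Ck_on U 2 f -> U x ->
  'D_w (fun y => 'D_v f y) x = 'D_v (fun y => 'D_w f y) x.
Proof.
move=> oU Cf Ux; have [df Df] := Cf; apply/rowP => k.
pose p (g : W -> 'rV[R]_m) (y : W) : R := pairing_right 'e_k (g y) + 0.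
have pD (g : W -> 'rV[R]_m) (y u : W) : differentiable g y -> 'D_u (p g) y = ('D_u g y) 0 k.
  move=> dg.
  have [_ ->] := derive_affine (0 : R) u (@pairing_right_continuous R m 'e_k) dg.
  exact: pairing_delta.
have nU : nbhs x U by exact: open_nbhs_nbhs.
have pDD (u u' : W) : ('D_u' (fun y => 'D_u f y) x) 0 k = 'D_u' (fun y => 'D_u (p f) y) x.
  rewrite -pD; last by have [d2 _] := Df u; exact: d2.
  apply: near_eq_derive; apply: filterS nU => y Uy.
  by rewrite pD; [rewrite /p addr0 -[RHS]pairing_delta|exact: df].
have Cp : Ck_on U 2 (p f) :=
  Ck_on_affine (0 : R) oU (@pairing_right_continuous R m 'e_k) Cf.
have swap := @derive_swap R W (p f) U x v w oU Cp Ux.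
exact: (etrans (pDD v w) (etrans swap (esym (pDD w v)))).
Qed.

Section LiftedDerivatives.
Variables (R : realType) (m : nat) (A : 'M[bool]_m).
Hypothesis hA : bott_matrix A.
Local Notation V := 'rV[R]_m.
Local Notation M := (bott_manifold R A).
Local Notation pr := (@pr R m A).

Variable phi : R -> M -> M.
Hypothesis phi_loc : forall (t : R) (u : V), t \in `[0, 1] ->
  exists U h, U (t, u) /\ isotopy_lift phi U h.
Variable X : R -> V -> V.
Hypothesis phiX : generated_by phi X.
Variables (w : V) (G : R * R -> V).
Hypothesis LG : lifted_line phi w G.

Local Notation lift_point := (fun z : R * R => (clamp 0 1 z.1, z.2 *: w) : R * V).

Definition space_derivative (z : R * R) : V := 'D_1 (fun s : R => G (z.1, s)) z.2.
(** Defined through [X] because the clamped lift need not be differentiable in time at 0 and 1,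
    where this formula still gives the right one-sided value. *)
Definition time_derivative (z : R * R) : V := X (clamp 0 1 z.1) (G z).
Definition mixed_derivative (z : R * R) : V :=
  'D_1 (fun t : R => space_derivative (t, z.2)) z.1.

Lemma is_derive_space (E : R * R -> V) (q : R * V -> V) (z : R * R) :
  (\forall z' \near z, E z' = q (lift_point z')) -> differentiable q (lift_point z) ->
  is_derive z.2 1 (fun s => E (z.1, s)) ('D_((0, w) : R * V) q (lift_point z)).
Proof.
case: z => t s nE dq /=.
have lineE s' : (clamp 0 1 t, s' *: w) = (clamp 0 1 t, 0) + s' *: ((0, w) : R * V).
  by congr (_, _); rewrite /= ?add0r// /GRing.scale/= mulr0 addr0.
rewrite /= lineE in dq *.
apply: near_eq_is_derive (is_derive_line dq).
by apply: filterS (near_slice_right nE) => s' ->; rewrite /= lineE.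
Qed.

Lemma is_derive_time (E : R * R -> V) (q : R * V -> V) (z : R * R) : z.1 \in `]0, 1[ ->
  (\forall z' \near z, E z' = q (lift_point z')) -> differentiable q (lift_point z) ->
  is_derive z.1 1 (fun t => E (t, z.2)) ('D_((1, 0) : R * V) q (lift_point z)).
Proof.
case: z => t s /= t01 nE dq.
have lineE t' : t' \in `]0, 1[ ->
    (clamp 0 1 t', s *: w) = (0, s *: w) + t' *: ((1, 0) : R * V).
  rewrite in_itv/= => /andP[/ltW t0 /ltW t1].
  rewrite clamp_id ?in_itv/= ?t0//.
  by congr (_, _); rewrite /= ?scaler0 ?addr0// add0r /GRing.scale/= mulr1.
rewrite /= lineE// in dq *.
apply: near_eq_is_derive (is_derive_line dq).
by apply: filterS2 (near_in_itvoo t01) (near_slice_left nE) => t' t'01 ->; rewrite /= lineE.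
Qed.

Lemma lifted_line_space_time (t s : R) : s \in `]-1, 2[ -> exists U h,
  [/\ open U, smooth_on U h, U (lift_point (t, s)) &
      \forall z \near (t, s), [/\ U (lift_point z), G z = h (lift_point z),
        is_derive z.2 1 (fun s => G (z.1, s)) ('D_((0, w) : R * V) h (lift_point z)) &
        time_derivative z = 'D_((1, 0) : R * V) h (lift_point z)]].
Proof.
move=> s02; have [U [h [Lh Uts nG]]] := lifted_line_local hA phi_loc t LG s02.
have [oU sh prh] := Lh.
exists U, h; split=> //.
(* Derivatives at a nearby [z] require agreement of [G] with the local lift near [z], not merely at
   [z]. *)
apply: filterS (near_join nG) => z nz.
have [Uz Gz] := nbhs_singleton nz.
split=> //.
  apply: is_derive_space; last by apply: (sh 1%N).1.
  by apply: filterS nz => z' [].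
rewrite /time_derivative Gz; have [_ gen] := phiX.
by rewrite (gen U h Lh)// clamp01.
Qed.

(** Continuity in time is not part of the data of [X]; along the lift, [X] is a directional
    derivative of a smooth [h], which is continuous. *)
Lemma lifted_line_regular (t s : R) : s \in `]-1, 2[ ->
  [/\ {for (t, s), continuous space_derivative},
      {for (t, s), continuous time_derivative} &
      is_derive s 1 (fun s => G (t, s)) (space_derivative (t, s))].
Proof.
move=> s02; have [U [h [oU sh Uts nG]]] := lifted_line_space_time t s02.
have ck := @continuous_lift_point R m w t s.
have cD v : {for (t, s), continuous (fun z => 'D_v h (lift_point z))}.
  apply: (@continuous_comp _ _ _ lift_point (fun y => 'D_v h y)); first exact: ck.
  exact: ((sh 1%N).2 v).
split.
- apply: near_eq_continuous (cD (0, w)).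
  by apply: filterS nG => z [_ _ [_ <-] _].
- apply: near_eq_continuous (cD (1, 0)).
  by apply: filterS nG => z [_ _ _ ->].
- have [_ _ dG _] := nbhs_singleton nG.
  by rewrite /space_derivative; apply: derivableP; case: dG.
Qed.

Lemma lifted_line_regular_interior (t s : R) : t \in `]0, 1[ -> s \in `]-1, 2[ ->
  [/\ is_derive t 1 (fun t => G (t, s)) (time_derivative (t, s)),
      is_derive t 1 (fun t => space_derivative (t, s)) (mixed_derivative (t, s)),
      is_derive s 1 (fun s => time_derivative (t, s)) (mixed_derivative (t, s)) &
      {for (t, s), continuous mixed_derivative}].
Proof.
move=> t01 s02; have [U [h [oU sh Uts nG]]] := lifted_line_space_time t s02.
have ck := @continuous_lift_point R m w t s.
pose e0 : R * V := (0, w); pose e1 : R * V := (1, 0).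
have n1 : \forall z \near (t, s), z.1 \in `]0, 1[.
  exact: (@continuous_fst R R (t, s) _ (near_in_itvoo t01)).
have dt : nbhs (t, s) [set z : R * R |
    is_derive z.1 1 (fun t => space_derivative (t, z.2))
      ('D_e1 (fun y => 'D_e0 h y) (lift_point z))].
  apply: filterS2 n1 (near_join nG) => z z01 nz.
  apply: (@is_derive_time space_derivative (fun y => 'D_e0 h y)) => //.
    by apply: filterS nz => z' [_ _ [_ <-] _].
  have [Uz _ _ _] := nbhs_singleton nz.
  by have [d2 _] := (sh 2%N).2 e0; exact: d2.
have [_ Gts _ Ets] := nbhs_singleton nG.
have [_ mE] := nbhs_singleton dt.
split.
- have nGh : nbhs (t, s) [set z | G z = h (lift_point z)] by apply: filterS nG => z [].
  have dh : differentiable h (lift_point (t, s)) by apply: (sh 1%N).1.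
  have D := is_derive_time (z := (t, s)) t01 nGh dh.
  by rewrite Ets; exact: D.
- by rewrite /mixed_derivative; apply: derivableP; case: (nbhs_singleton dt).
- have nGt : nbhs (t, s) [set z | time_derivative z = 'D_e1 h (lift_point z)].
    by apply: filterS nG => z [].
  have dh : differentiable (fun y => 'D_e1 h y) (lift_point (t, s)).
    by have [d2 _] := (sh 2%N).2 e1; exact: d2.
  have D := is_derive_space nGt dh.
  (* [mixed_derivative] differentiates in space first, whereas this goal differentiates the time
     derivative in space. *)
  have swap := derive_swap_row e0 e1 oU (sh 2%N) Uts.
  by rewrite /mixed_derivative mE swap; exact: D.
- pose q z := 'D_e1 (fun y => 'D_e0 h y) (lift_point z).
  have nE : nbhs (t, s) [set z | q z = mixed_derivative z].
    by apply: filterS dt => z [_ dE]; exact: (esym dE).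
  have c2 : {for lift_point (t, s), continuous (fun y => 'D_e1 (fun y => 'D_e0 h y) y)}.
    by have [_ d2] := (sh 2%N).2 e0; exact: d2.
  exact: (near_eq_continuous nE (continuous_comp ck c2)).
Qed.

End LiftedDerivatives.

(** * The flux group *)

Section FluxPeriods.
Variables (R : realType) (m : nat) (A : 'M[bool]_m).
Hypothesis hA : bott_matrix A.
Variable c : 'I_m -> 'I_m -> R.
Local Notation V := 'rV[R]_m.
Local Notation M := (bott_manifold R A).
Local Notation Gamma := (@Gamma R m A).
Local Notation pr := (@pr R m A).
Local Notation zcp := (@zero_column_part R m A).
Local Notation Om := (bott_form_mx A c).
Local Notation omega := (bott_form A c).
Notation mu := (@lebesgue_measure R).
Notation "\int01 f" := (\int[mu]_(s in `[0, 1]) f s) (at level 10, f at level 9).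
Local Notation om v w := (pairing (v *m Om) w).

Section Loop.
Variable phi : R -> M -> M.
Hypothesis phi_loc : forall (t : R) (u : V), t \in `[0, 1] ->
  exists U h, U (t, u) /\ isotopy_lift phi U h.
Hypothesis phi0 : phi 0 = id.
Variable X : R -> V -> V.
Hypothesis phiX : generated_by phi X.
Variables (j : 'I_m) (G : R * R -> V).
Hypothesis LG : lifted_line phi 'e_j G.
Local Notation Gs := (space_derivative G).
Local Notation Gt := (time_derivative X G).
Local Notation Gst := (mixed_derivative G).

Lemma itv01_sub (s : R) : s \in `[0, 1] -> s \in `]-1, 2[.
Proof. by rewrite !in_itv/=; lra. Qed.

Lemma lifted_line_period t : G (t, 1) = G (t, 0) + 'e_j.
Proof.
apply: (lifted_line_time hA phi0 LG LG _ _ (Gamma_translation_delta R A j)).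
- by rewrite in_itv/=; lra.
- by rewrite in_itv/=; lra.
- by rewrite scale1r scale0r add0r.
Qed.

(** The slice at time [t] ends at the translate of its starting point by ['e_j], so a primitive of
    [a] grows along it by exactly the period. *)
Lemma contraction_period t (a : closed_form R A) : t \in `[0, 1] ->
  form_coef a = Defs.contraction omega (X t) ->
  period j (coh_class a) = \int01 (fun s => om (Gt (t, s)) (Gs (t, s))).
Proof.
move=> t01 aX.
have aE u : a u = X t u *m Om.
  by rewrite aX; apply/rowP => k; rewrite mxE bott_formE pairing_delta.
have [_ dP DP] := primitiveP a.
have c1 (s : R) : s \in `[0, 1] -> {for s, continuous (fun s => om (Gt (t, s)) (Gs (t, s)))}.
  move=> /itv01_sub s02; have [c1 c2 _] := lifted_line_regular hA phi_loc phiX LG t s02.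
  exact: (continuous_om (continuous_slice c2) (continuous_slice c1)).
have c2 (s : R) : s \in `]0, 1[ ->
    is_derive s 1 (fun s => primitive a (G (t, s))) (om (Gt (t, s)) (Gs (t, s))).
  move=> s01; have s02 : s \in `]-1, 2[ by move: s01; rewrite !in_itv/=; lra.
  have [_ _ dG] := lifted_line_regular hA phi_loc phiX LG t s02.
  have := differentiable_along (dP (G (t, s))) dG.
  by rewrite DP aE /time_derivative clamp_id.
have c3 (s : R) : s \in `[0, 1] -> {for s, continuous (fun s => primitive a (G (t, s)))}.
  move=> /itv01_sub s02; have [cG _ _ _] := LG.
  have cP : {for G (t, s), continuous (primitive a)} by exact: differentiable_continuous.
  exact: (continuous_comp (@continuous_slice _ _ _ G t s (cG (t, s))) cP).
rewrite (FTC01 c1 c2 c3) lifted_line_period form_period_translate//.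
by rewrite addrC addKr period_coh_class.
Qed.

Lemma loop_area (b : V) : (forall s : R, s \in `[-1, 2] -> G (1, s) = s *: 'e_j + b) ->
  \int01 (fun t => \int01 (fun s => om (Gt (t, s)) (Gs (t, s)))) = om b 'e_j.
Proof.
move=> G1.
have sk := bott_form_mx_skew A c.
have G0 (s : R) : s \in `[-1, 2] -> G (0, s) = s *: 'e_j := lifted_line0 hA phi0 LG.
have omee : om ('e_j : V) 'e_j = 0 by have := pairing_skew 'e_j 'e_j sk; lra.
have Gs_line (t : R) (b' : V) : (forall s : R, s \in `[-1, 2] -> G (t, s) = s *: 'e_j + b') ->
    forall s : R, s \in `]-1, 2[ -> Gs (t, s) = 'e_j.
  move=> Gt' s s02; rewrite /space_derivative /=.
  have lineE : \forall s' \near s, b' + s' *: ('e_j : V) = G (t, s').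
    apply: filterS (near_in_itvoo s02) => s' s'02.
    by rewrite Gt' 1?addrC//; move: s'02; rewrite !in_itv/=; lra.
  rewrite -(near_eq_derive (1 : R) lineE).
  by have [_ ->] := is_derive_parametrized_line b' ('e_j : V) s.
have [cG _ _ _] := LG.
have h1 (t s : R) : s \in `[0, 1] -> [/\ {for (t, s), continuous G},
    {for (t, s), continuous Gs} & {for (t, s), continuous Gt}].
  move=> /itv01_sub s02.
  have [c1 c2 _] := lifted_line_regular hA phi_loc phiX LG t s02.
  by split; [exact: cG|exact: c1|exact: c2].
have h2 (t s : R) : t \in `]0, 1[ -> s \in `[0, 1] ->
    [/\ is_derive t 1 (fun t => G (t, s)) (Gt (t, s)),
        is_derive t 1 (fun t => Gs (t, s)) (Gst (t, s)),
        is_derive s 1 (fun s => G (t, s)) (Gs (t, s)),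
        is_derive s 1 (fun s => Gt (t, s)) (Gst (t, s)) &
        {for (t, s), continuous Gst}].
  move=> t01 /itv01_sub s02.
  have [_ _ dG] := lifted_line_regular hA phi_loc phiX LG t s02.
  have [d1 d2 d3 c4] := lifted_line_regular_interior hA phi_loc phiX LG t01 s02.
  by split.
(* The value at time 0 vanishes. At time 1, [om b 'e_j] occurs twice, from the integral over the
   edge and from [- om 'e_j b], which cancels the factor 1/2. *)
rewrite (swept_area sk h1 h2 lifted_line_period).
have -> : \int01 (fun s => om (G (1, s)) (Gs (1, s))) = om b 'e_j.
  rewrite -[RHS]Rintegral01_cst; apply: eq_Rintegral => s.
  rewrite inE /= => s01; rewrite (Gs_line 1 b)//; last exact: itv01_sub.
  rewrite G1; last by move: s01; rewrite !in_itv/=; lra.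
  by rewrite mulmxDl pairingDl -scalemxAl pairingZl omee mulr0 add0r.
have -> : \int01 (fun s => om (G (0, s)) (Gs (0, s))) = 0.
  rewrite -[RHS]Rintegral01_cst; apply: eq_Rintegral => s.
  rewrite inE /= => s01; rewrite (Gs_line 0 0); last exact: itv01_sub.
    rewrite G0; last by move: s01; rewrite !in_itv/=; lra.
    by rewrite -scalemxAl pairingZl omee mulr0.
  by move=> s' s'02; rewrite addr0 G0.
have i0 : 0 \in `[-1, 2 : R] by rewrite in_itv/=; lra.
rewrite G1// G0// scale0r add0r [pairing _ 0]pairingC pairing0l.
by rewrite [om 'e_j b]pairing_skew//; field.
Qed.

End Loop.

Lemma flux_groupP (x : H1 A) : flux_group A omega x <-> exists b : V,
  [/\ Gamma (fun u => u + b), zcp b = b & x = coh_class (constant_form hA (b *m Om))].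
Proof.
split=> [[phi [[_ loc phi0] phi1 [X [a [gen coef int]]]]]|[b [Gb bz ->]]]; last first.
  exact: translation_flux.
have [b [Gb bz monob]] := monodromy hA loc phi0 phi1.
exists b; split=> //; apply: (period_eq hA) => j zj; rewrite period_constant//.
have [G LG] := lifted_line_exists hA loc phi0 'e_j.
(* The weak integral is tested on the functional [period j], so the period of the flux is the time
   integral of the periods of the slices. *)
have [_ <-] := int (period j : {scalar H1 A}).
rewrite -[RHS]pairing_delta -(loop_area loc phi0 gen LG (fun s => monob j G s LG)).
apply: eq_Rintegral => t; rewrite inE /= => t01.
exact: (contraction_period loc phi0 gen LG t01 (coef t t01)).
Qed.

End FluxPeriods.

(** * The lattice property *)

Section FluxLattice.
Variables (R : realType) (m : nat) (A : 'M[bool]_m).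
Hypothesis hA : bott_matrix A.
Variable c : 'I_m -> 'I_m -> R.
Hypothesis nd : nondegenerate_form (bott_form A c).
Local Notation V := 'rV[R]_m.
Local Notation Gamma := (@Gamma R m A).
Local Notation zcp := (@zero_column_part R m A).
Local Notation Om := (bott_form_mx A c).
Local Notation flux := (flux_group A (bott_form A c)).
Local Notation d := #|zero_column A|.

Definition period_row (x : H1 A) : 'rV[R]_d := \row_i period (enum_val i) x.

Lemma period_row_is_linear : linear period_row.
Proof.
by move=> a x y; apply/rowP => i; rewrite !mxE linearP.
Qed.

HB.instance Definition _ :=
  GRing.isLinear.Build R (H1 A) 'rV[R]_d _ period_row period_row_is_linear.

Definition zero_column_incl : 'M[R]_(d, m) := \matrix_(i, j) (enum_val i == j)%:R.

Lemma mul_zero_column_incl (y : 'rV[R]_d) (i : 'I_d) :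
  (y *m zero_column_incl) 0 (enum_val i) = y 0 i.
Proof.
rewrite mxE (bigD1 i)//= mxE eqxx mulr1 big1 ?addr0// => k ki.
by rewrite mxE (inj_eq enum_val_inj) (negPf ki) mulr0.
Qed.

Lemma mul_zero_column_incl0 (y : 'rV[R]_d) j : ~~ zero_column A j ->
  (y *m zero_column_incl) 0 j = 0.
Proof.
move=> zj; rewrite mxE big1// => k _; rewrite mxE.
case: eqP => [kj|_]; last by rewrite mulr0.
by move: zj; rewrite -kj => /negP[]; exact: (enum_valP k).
Qed.

Lemma zero_column_enum j : zero_column A j -> exists i : 'I_d, j = enum_val i.
Proof.
by move=> zj; exists (enum_rank_in (zj : j \in zero_column A) j); rewrite enum_rankK_in.
Qed.

Lemma period_row_bij : bijective period_row.
Proof.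
exists (fun y => coh_class (constant_form hA (y *m zero_column_incl))) => [x|y].
  apply: (period_eq hA) => j zj; rewrite period_constant//.
  by have [i ->] := zero_column_enum zj; rewrite mul_zero_column_incl mxE.
apply/rowP => i; rewrite mxE period_constant ?mul_zero_column_incl//.
exact: (enum_valP i).
Qed.

(** A fixed linear map recovers the translation vector from the coordinates of its flux. Being
    continuous, it transfers discreteness of half-integer vectors to the flux group. *)
Lemma period_row_flux (b : V) : zcp b = b ->
  period_row (coh_class (constant_form hA (b *m Om))) *m (zero_column_incl *m invmx Om) = b.
Proof.
move=> bz; rewrite mulmxA; have Omu := bott_form_mx_unit nd.
rewrite -[RHS](mulmxK Omu); congr (_ *m _); apply/rowP => j.
have [zj|zj] := boolP (zero_column A j).
  have [i ji] := zero_column_enum zj.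
  by rewrite {1}ji mul_zero_column_incl mxE -ji period_constant.
rewrite mul_zero_column_incl0//.
by rewrite -bz zero_column_part_mulmx mxE (negPf zj).
Qed.

Lemma Gamma_translation_half_int (b : V) : Gamma (fun u => u + b) ->
  forall j, exists z : int, b 0 j = z%:~R / 2.
Proof.
move=> /(Gamma_affineP hA)[D [b' [gE _ _ _ b'z]]] j.
by have := gE 0; rewrite add0r mul0mx add0r => ->.
Qed.

Lemma half_int_eq (x y : int) : `|(x%:~R / 2 : R) - y%:~R / 2| < 2^-1 -> x = y.
Proof.
rewrite -mulrBl normrM [`|2^-1|]ger0_norm// -rmorphB/= -intr_norm.
rewrite ltr_pdivrMr// mulVf// ltrz1 => xy.
by apply/eqP; rewrite -subr_eq0; move: xy; case: (x - y) => [[|k]|k].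
Qed.

Lemma flux_subgroup : subgroup flux.
Proof.
split.
  apply/(flux_groupP hA c); exists 0; split.
  - by rewrite (_ : (fun u : V => u + 0) = id); [exact: Gamma_id|apply/funext => u; rewrite addr0].
  - by apply/rowP => j; rewrite !mxE; case: ifP.
  - by apply: (period_eq hA) => j zj; rewrite period_constant// mul0mx linear0 mxE.
move=> x y /(flux_groupP hA c)[b [Gb bz ->]] /(flux_groupP hA c)[b' [Gb' bz' ->]].
apply/(flux_groupP hA c); exists (b - b'); split.
- have -> : (fun u : V => u + (b - b')) = (fun u => u - b') \o (fun u => u + b).
    by apply/funext => u; rewrite /= addrA.
  apply: Gamma_comp Gb; apply: (Gamma_inv Gb') => u; first by rewrite addrK.
  by rewrite subrK.
- by rewrite addrC -scaleN1r zero_column_part_linear bz bz'.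
- apply: (period_eq hA) => j zj.
  by rewrite linearB/= !period_constant// mulmxBl !mxE.
Qed.

Lemma flux_discrete : discrete_in flux.
Proof.
exists d, period_row; split; first exact: period_row_bij.
move=> _ [x xf <-]; split; first by apply/mem_set; exists x.
have /(flux_groupP hA c)[b [Gb bz xE]] := xf.
set N : 'M[R]_(d, m) := zero_column_incl *m invmx Om.
have cN : {for period_row x, continuous (fun y : 'rV[R]_d => y *m N)}.
  move=> P; exact: (@mulmx_continuous R d m N (period_row x) P).
(* The radius 1/2 is the spacing of half-integers: translation vectors closer than this coincide. *)
have /cvgrPdist_lt/(_ 2^-1) := cN; rewrite invr_gt0 ltr0n => /(_ isT) nN.
exists [set y : 'rV[R]_d | `|period_row x *m N - y *m N| < 2^-1]; first exact: nN.
apply/seteqP; split=> [y [/= yx [x' xf' yE]]|_ ->].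
  move: yx; rewrite -yE /= => yx.
  have /(flux_groupP hA c)[b' [Gb' bz' xE']] := xf'.
  move: yx; rewrite xE xE' !period_row_flux// => bb'.
  suff -> : b' = b by [].
  apply/rowP => j; have bbj := le_lt_trans (row_coord_le (b - b') j) bb'.
  have [z bj] := Gamma_translation_half_int Gb j.
  have [z' bj'] := Gamma_translation_half_int Gb' j.
  by move: bbj; rewrite !mxE bj bj' => /half_int_eq ->.
by split; [rewrite /= subrr normr0 invr_gt0 ltr0n|exists x].
Qed.

Lemma flux_spanning : spanning flux.
Proof.
move=> x; have Omu := bott_form_mx_unit nd.
have zcpK (v : V) : zcp (zcp v) = zcp v by apply/rowP => j; rewrite !mxE; case: (zero_column A j).
pose p : V := zcp (\row_j period j x).
pose b := p *m invmx Om.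
have bOm : b *m Om = p by rewrite mulmxKV.
(* Summing over all [m] coordinates avoids enumerating J: outside J the projected vector is 0 and
   contributes the zero class, which is the flux of the constant loop. *)
exists m, (fun j => b 0 j), (fun j => coh_class (constant_form hA (zcp 'e_j *m Om))).
split=> [j|].
  apply/(flux_groupP hA c); exists (zcp 'e_j); split=> //.
  have [zj|zj] := boolP (zero_column A j).
    have -> : zcp 'e_j = 'e_j; last exact: Gamma_translation_delta.
    apply/rowP => k; rewrite !mxE eqxx/=; case: ifPn => // zk.
    by case: eqP => // kj; rewrite kj zj in zk.
  have -> : zcp 'e_j = 0.
    apply/rowP => k; rewrite !mxE eqxx/=; case: ifPn => // zk.
    by case: eqP => // kj; rewrite -kj zk in zj.
  by rewrite (_ : (fun u : V => u + 0) = id); [exact: Gamma_id|apply/funext => u; rewrite addr0].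
apply: (period_eq hA) => k zk; rewrite linear_sum/=.
have -> : period k x = (b *m Om) 0 k by rewrite bOm mxE zk mxE.
rewrite mxE; apply: eq_bigr => j _.
rewrite linearZ/= period_constant// zero_column_part_mulmx; congr (_ * _).
by rewrite [RHS]mxE zk -rowE [RHS]mxE.
Qed.

End FluxLattice.

Theorem theorem4p1 (R : realType) (n : nat) (hn : (1 <= n)%N)
    (A : 'M[bool]_(2 * n)) (hA : bott_matrix A)
    (c : 'I_(2 * n) -> 'I_(2 * n) -> R)
    (homega : nondegenerate_form (bott_form A c)) :
  full_rank_lattice (flux_group A (bott_form A c)).
Proof.
split; [exact: flux_subgroup|exact: flux_discrete|exact: flux_spanning].
Qed.
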